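(* Consider the cancel-on-completion (c.o.c.) variant of the fork-join$(n_{\mathrm F},n_{\mathrm J})$ model on $N$ servers with the FCFS discipline, in steady state, where $1\le n_{\mathrm J}\le n_{\mathrm F}\le N$. Let $$\rho_{\mathrm U}=\frac{\mathbb{E}[B_{(n_{\mathrm J})}]}{\mathbb{E}[A]},\qquad \rho_{\mathrm L}=\frac{\mathbb{E}[B_{(n_{\mathrm J})}]}{K\,\mathbb{E}[A]},\qquad K=\binom{N}{n_{\mathrm F}}\frac{n_{\mathrm F}!}{(n_{\mathrm F}-n_{\mathrm J}+1)!}.$$ If $\rho_{\mathrm U}<1$ and the residual job size $B_{(n_{\mathrm J})}^{\mathrm{res}}$ is subexponential, then, as $x\to\infty$, $$(1+o(1))\,\frac{\rho_{\mathrm L}}{1-\rho_{\mathrm L}}\,\bar B^{\mathrm{res}}_{(n_{\mathrm J})}(x)\ \le\ \mathbb{P}(W_{(n_{\mathrm J})}>x)\ \le\ (1+o(1))\,\frac{\rho_{\mathrm U}}{1-\rho_{\mathrm U}}\,\bar B^{\mathrm{res}}_{(n_{\mathrm J})}(x).$$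
   Context: Model. There are $N$ parallel unit-speed servers, each serving in first-come first-served (FCFS) order. Jobs arrive at the epochs of a renewal process with i.i.d. interarrival times distributed as $A$, with finite mean. On arrival of a job, replicas of it are assigned to $n_{\mathrm F}$ distinct servers chosen uniformly at random. The replica sizes $(B_1,\dots,B_{n_{\mathrm F}})$ of a job have some joint distribution, with each $B_i$ distributed as $B$ but not necessarily independent of each other; the vectors for different jobs are i.i.d. and independent of arrivals and server choices. In the c.o.c. variant, as soon as $n_{\mathrm J}$ of the $n_{\mathrm F}$ replicas of a job have finished service, its remaining replicas are abandoned and the job is completed. For random variables $X_1,\dots,X_n$, $X_{(j)}$ denotes the $j$-th order statistic ($j$-th smallest). $W_1,\dots,W_{n_{\mathrm F}}$ are the steady-state waiting times of the replicas of a job at its $n_{\mathrm F}$ servers (the time until the replica's service starts if it is still in the system then), and $W_{(n_{\mathrm J})}$ and $B_{(n_{\mathrm J})}$ are the $n_{\mathrm J}$-th order statistics of $W_1,\dots,W_{n_{\mathrm F}}$ and $B_1,\dots,B_{n_{\mathrm F}}$. $B^{\mathrm{res}}_{(n_{\mathrm J})}$ has tail $\bar B^{\mathrm{res}}_{(n_{\mathrm J})}(x)=\mathbb{P}(B^{\mathrm{res}}_{(n_{\mathrm J})}>x)=\frac{1}{\mathbb{E}[B_{(n_{\mathrm J})}]}\int_x^\infty\mathbb{P}(B_{(n_{\mathrm J})}>y)\,dy$. A random variable $X$ is subexponential if $\mathbb{P}(X_1+X_2>x)/\mathbb{P}(X>x)\to2$ as $x\to\infty$, with $X_1,X_2$ independent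 copies of $X$. *)

(* Defs.v *)
From HB Require Import structures.
From mathcomp Require Export all_boot all_order all_algebra.
From mathcomp Require Export all_classical all_reals all_analysis.

Set Implicit Arguments.
Unset Strict Implicit.
Unset Printing Implicit Defensive.

Import Order.TTheory GRing.Theory Num.Theory.
Import numFieldNormedType.Exports.

Local Open Scope classical_set_scope.
Local Open Scope ring_scope.

Section Probability.
Context {d : measure_display} {Omega : measurableType d} {R : realType}.
Variable P : probability Omega R.

(* Restricted to measurable sets: off the sigma-algebra the values of a measure
   are unconstrained. *)
Definition same_law {d' : measure_display} {T : measurableType d'}
    (X Y : Omega -> T) : Prop :=
  forall E : set T, measurable E -> P (X @^-1` E) = P (Y @^-1` E).

(* The product rule over every finite subfamily; the subfamily is enumerated
   without repetition by [j]. *)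
Definition mutually_independent {I : Type} (F : I -> set (set Omega)) : Prop :=
  forall (k : nat) (j : 'I_k -> I), injective j ->
  forall E : 'I_k -> set Omega, (forall i, F (j i) (E i)) ->
    P (\bigcap_i E i) = (\prod_(i < k) P (E i))%E.

(* P(X^res > x), for x >= 0 and X a nonnegative random variable. *)
Definition residual_tail (X : Omega -> R) (x : R) : \bar R :=
  (('E_P[X])^-1 *
   \int[lebesgue_measure]_(y in `]x, +oo[) P [set w | (y < X w)%R])%E.

End Probability.

Definition tail_prob {R : realType} (nu : probability R R) (x : R) : R :=
  fine (nu `]x, +oo[%classic).

(* [nu \x nu] is the joint law of two independent copies. *)
Definition subexponential {R : realType} (nu : probability R R) : Prop :=
  fine ((nu \x nu)%E [set z : R * R | x < z.1 + z.2]) / tail_prob nu x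
    @[x --> +oo] --> (2 : R).

(* The j-th smallest entry, j = 1, ..., size s. *)
Definition order_stat {R : realType} (j : nat) (s : seq R) : R :=
  nth 0 (sort <=%O s) j.-1.

Section Dynamics.
Context {R : realType} {N nF : nat}.
Variable nJ : nat.

(* [v] lists, for each server, the time until it has finished with all jobs that
   arrived earlier; [s i] is the server of replica [i] and [b] lists the replica
   sizes.  By FCFS, replica [i] starts after [v_(s i)] if it is not abandoned
   before. *)
Definition waiting_times (v : N.-tuple R) (s : {ffun 'I_nF -> 'I_N}) :
    nF.-tuple R :=
  [tuple tnth v (s i) | i < nF].

(* Time from the arrival of a job to the nJ-th service completion among its
   replicas; abandonments happen only afterwards, so they do not affect it. *)
Definition completion_time (v : N.-tuple R) (s : {ffun 'I_nF -> 'I_N})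
    (b : nF.-tuple R) : R :=
  order_stat nJ [tuple tnth (waiting_times v s) i + tnth b i | i < nF].

(* The update of [v] by the new job: a replica still waiting at the completion
   time [c] of its job never occupies its server; otherwise it occupies it until
   it is finished or abandoned. *)
Definition assign_job (v : N.-tuple R) (s : {ffun 'I_nF -> 'I_N})
    (b : nF.-tuple R) : N.-tuple R :=
  let c := completion_time v s b in
  [tuple if [pick i | s i == k] is Some i then
           if c <= tnth v k then tnth v k else Num.min (tnth v k + tnth b i) c
         else tnth v k
  | k < N].

Definition elapse (a : R) (v : N.-tuple R) : N.-tuple R :=
  [tuple Num.max 0 (tnth v k - a) | k < N].

End Dynamics.

Variant input :=
  | Initial | Interarrival of nat | Sizes of nat | Servers of nat.

Section Model.
Context {d : measure_display} {Omega : measurableType d} {R : realType}.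
Variable P : probability Omega R.
Context {N nF : nat}.
Variable nJ : nat.

(* Jobs are numbered by [n : nat].  [A n] is the time between the arrivals of
   jobs [n] and [n.+1]; [B n] and [S n] are the replica sizes and servers of job
   [n]; [V n] is the vector of residual busy times of the servers found by job
   [n] upon arrival. *)
Variables (A : nat -> {RV P >-> R}) (B : nat -> {RV P >-> nF.-tuple R}).
Variable S : nat -> Omega -> {ffun 'I_nF -> 'I_N}.
Variable V : nat -> {RV P >-> N.-tuple R}.

Definition input_events (i : input) : set (set Omega) :=
  match i with
  | Initial => g_sigma_algebra_preimage (V 0%N)
  | Interarrival n => g_sigma_algebra_preimage (A n)
  | Sizes n => g_sigma_algebra_preimage (B n)
  | Servers n => [set S n @^-1` E | E in [set: set {ffun 'I_nF -> 'I_N}]]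
  end.

Record coc_fork_join : Prop := {
  interarrival_ge0 : forall n w, 0 <= A n w ;
  interarrival_law : forall n, same_law P (A n) (A 0%N) ;
  interarrival_mean : ('E_P[A 0%N] < +oo)%E ;
  size_ge0 : forall n w i, 0 <= tnth (B n w) i ;
  sizes_law : forall n, same_law P (B n) (B 0%N) ;
  size_marginals : forall i j : 'I_nF,
    same_law P (fun w => tnth (B 0%N w) i) (fun w => tnth (B 0%N w) j) ;
  servers_distinct : forall n w, injective (S n w) ;
  servers_measurable : forall n s, measurable (S n @^-1` [set s]) ;
  servers_uniform : forall n (s : {ffun 'I_nF -> 'I_N}), injective s ->
    P (S n @^-1` [set s]) = ((N ^_ nF)%:R^-1)%:E ;
  inputs_independent : mutually_independent P input_events ;
  initial_ge0 : forall w k, 0 <= tnth (V 0%N w) k ;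
  workload_recursion : forall n w,
    V n.+1 w = elapse (A n w) (assign_job nJ (V n w) (S n w) (B n w))
}.

(* [V] is a Markov chain, so equality of its one-dimensional laws makes the whole
   process stationary. *)
Definition steady_state : Prop := forall n, same_law P (V n) (V 0%N).

(* W_(nJ) for job [n] *)
Definition wait_stat (n : nat) (w : Omega) : R :=
  order_stat nJ (waiting_times (V n w) (S n w)).

(* B_(nJ); all jobs have the same size law, so job 0 represents them. *)
Definition size_stat (w : Omega) : R := order_stat nJ (B 0%N w).

Definition Kconst : R :=
  'C(N, nF)%:R * (nF`!)%:R / ((nF - nJ + 1)`!)%:R.

(* The loads are extended reals, so that rhoU < 1 excludes an infinite
   E[B_(nJ)]. *)
Definition rhoU : \bar R := ('E_P[size_stat] / 'E_P[A 0%N])%E.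

Definition rhoL : \bar R := ('E_P[size_stat] / (Kconst%:E * 'E_P[A 0%N]))%E.

End Model.

Arguments coc_fork_join {d Omega R} P {N nF} nJ A B S V.
Arguments steady_state {d Omega R} P {N} V.
Arguments wait_stat {d Omega R} P {N nF} nJ S V n w.
Arguments size_stat {d Omega R} P {nF} nJ B w.
Arguments Kconst R N nF nJ : clear implicits.
Arguments rhoU {d Omega R} P {nF} nJ A B.
Arguments rhoL {d Omega R} P N {nF} nJ A B.

(* Main.v *)
From mathcomp Require Import perm.
Require Import Defs.
From mathcomp Require Import measurable_realfun ring lra zify.

(** Both bounds compare the backlogs of the servers with the workload of a single
    server, and read off the tail of a stationary workload from the fact that the
    mean of its (capped) excess over a level [x] does not change when a job
    arrives. Write [al] and [b] for the means of an interarrival time [A] and of the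
    order statistic [X] of the sizes, [H] for the residual tail, and [f] for the tail of the
    workload in question.

    Upper bound. A job is completed at most [X] after the largest backlog [M] that it
    finds, so the next job finds at most [Num.max 0 (M + X - A)]; moreover its wait is
    at most [M]. The mean excess of [M] over [x] increases through arrivals that
    cross the level and decreases, by almost [al] per arrival, when [M] is far above the
    level. This balance is [upper_step]:
      [(al - e) * f (x + L) <= b * (H (x - T) + l * both_large_tail T x + f (x - T))],
    where [l] bounds [f / H] on [[0, x]]. Subexponentiality makes [H (x - T)] and [H x]
    equivalent ([long_tailed]) and the tail of two large residual sizes negligible
    ([both_large_small]). Since [b < al], the inequality first shows that [f / H] is
    bounded ([tail_ratio_bounded]), and then that its limit superior [lam] satisfies
    [al * lam <= b * (1 + lam)], hence [lam <= b / (al - b)] ([tail_ratio_limsup]).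

    Lower bound. Fix the servers of an arriving job and a set [T] of [nF - nJ + 1] of
    them; the wait is at least the smallest backlog [U] on [T]. A job that puts its
    [nF - nJ + 1] largest replicas on [T] raises [U] by at least [X]
    ([covers_assign_job]), and no job lowers it. Whatever the sizes, the servers are
    chosen in this way with probability at least the inverse of the constant [K]
    ([card_covers]), so [U] grows at least like the workload of a server that gets
    this fraction of the jobs. In the balance of the mean excess it is now enough
    to keep the single jumps from below the level ([lower_step]):
      [(1 - f x) * P(A <= T) * (c * H (x + T)) <= (al - c) * f x] with [c = b / K].
    As [f] vanishes at infinity and [H] is long-tailed, the limit inferior of [f / H] is at
    least [c / (al - c)].

    Both bounds concern the backlogs found by job [0]. The wait of job [n] is a mixture over
    the servers of job [n], which are independent of the backlogs that it finds
    ([backlogs_indep_servers]); by stationarity the latter have the law of those found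
    by job [0]. *)

Set Implicit Arguments.
Unset Strict Implicit.
Unset Printing Implicit Defensive.
Import Order.TTheory GRing.Theory Num.Theory.
Import numFieldNormedType.Exports.
Local Open Scope classical_set_scope.
Local Open Scope ring_scope.

(** * Mean excesses as integrals of tails *)

Section MeasurableComparisons.
Context {d : measure_display} {Omega : measurableType d} {R : realType}.
Implicit Types X Y : Omega -> R.

Lemma measurable_ltr_set X Y : measurable_fun setT X -> measurable_fun setT Y ->
  measurable [set w | X w < Y w].
Proof.
move=> mX mY.
have := measurable_fun_ltr mX mY => /(_ measurableT [set true] I).
by rewrite setTI; congr measurable; apply/seteqP; split => w //=.
Qed.

Lemma measurable_ler_set X Y : measurable_fun setT X -> measurable_fun setT Y ->
  measurable [set w | X w <= Y w].
Proof.
move=> mX mY; rewrite [X in measurable X](_ : _ = ~` [set w | Y w < X w]).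
  by apply: measurableC; exact: measurable_ltr_set.
by apply/seteqP; split => w /=; [rewrite leNgt => /negP | move/negP; rewrite -leNgt].
Qed.

End MeasurableComparisons.

Section Layers.
Context {d : measure_display} {Omega : measurableType d} {R : realType}.
Variable P : probability Omega R.
Implicit Types (E : set Omega) (X Y : Omega -> R).

Let layers E (l r : Omega -> R) : set (Omega * measurableTypeR R) :=
  [set z | E z.1 /\ l z.1 < z.2 < r z.1].

Let measurable_layers_set E l r : measurable E ->
  measurable_fun setT l -> measurable_fun setT r -> measurable (layers E l r).
Proof.
move=> mE ml mr.
have ->: layers E l r =
    (fst @^-1` E) `&` ([set z | l z.1 < z.2] `&` [set z | z.2 < r z.1]).
  by apply/seteqP; split=> z /=;
    [case=> ? /andP[]|case=> ? [? ?]; split => //; apply/andP].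
apply: measurableI; first by rewrite -[X in measurable X]setTI; exact: measurable_fst.
apply: measurableI; apply: measurable_ltr_set => //.
- exact: measurableT_comp ml measurable_fst.
- exact: measurableT_comp mr measurable_fst.
Qed.

Let ysection_layers E l r y :
  ysection (layers E l r) y = E `&` [set w | l w < y < r w].
Proof. by apply/seteqP; split=> w /=; rewrite /ysection /= inE. Qed.

Lemma measurable_layers E (l r : Omega -> R) : measurable E ->
    measurable_fun setT l -> measurable_fun setT r ->
  measurable_fun (T := measurableTypeR R) (U := \bar R) setT
    (fun y => P (E `&` [set w | (l w < y < r w)%R])).
Proof.
move=> mE ml mr; have := measurable_fun_ysection P (measurable_layers_set mE ml mr).
by congr measurable_fun; apply/funext => y /=; rewrite ysection_layers.
Qed.

(** Tonelli: [Num.max 0 (r w - l w)] is the length of the set of levels between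
    [l w] and [r w]. All the means below are computed level by level this way. *)
Lemma integral_layers E (l r : Omega -> R) : measurable E ->
    measurable_fun setT l -> measurable_fun setT r ->
  (\int[P]_(w in E) (Num.max 0 (r w - l w))%:E =
   \int[lebesgue_measure]_y P (E `&` [set w | (l w < y < r w)%R]))%E.
Proof.
move=> mE ml mr.
have mC := measurable_layers_set mE ml mr; set C := layers E l r in mC.
have := indic_fubini_tonelli P (@lebesgue_measure R) mC.
rewrite indic_fubini_tonelli_FE// indic_fubini_tonelli_GE//.
move=> H; transitivity (\int[P]_w (lebesgue_measure \o xsection C) w)%E; last first.
  by rewrite H; apply: eq_integral => y _ /=; rewrite ysection_layers.
rewrite integral_mkcond; apply: eq_integral => w _ /=.
rewrite patchE; case: ifPn => [/set_mem Ew|/negP nEw]; last first.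
  rewrite (_ : xsection C w = set0) ?measure0//.
  by apply/seteqP; split=> y //=; rewrite /xsection /= inE /= => -[] /mem_set.
rewrite (_ : xsection C w = `]l w, r w[%classic); last first.
  apply/seteqP; split=> y /=; rewrite /xsection /= inE /C /= in_itv /=; first by case.
  by move=> ?; split.
rewrite lebesgue_measure_itv /= lte_fin.
case: ltP => h; first by rewrite -EFinB max_r// subr_ge0 ltW.
by rewrite max_l// subr_le0.
Qed.

End Layers.

(** * Finite measures and independence *)

Section RealMeasure.
Context {d : measure_display} {T : measurableType d} {R : realType}.
Variable m : {measure set T -> \bar R}.
Hypothesis mfin : (m setT < +oo)%E.

Lemma measure_fin_num (E : set T) : measurable E -> m E \is a fin_num.
Proof.
move=> mE; rewrite ge0_fin_numE//; apply: le_lt_trans mfin.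
by apply: le_measure; rewrite ?inE.
Qed.

Lemma fine_measure_le (E F : set T) : measurable E -> measurable F -> E `<=` F ->
  fine (m E) <= fine (m F).
Proof.
move=> mE mF EF; rewrite fine_le ?measure_fin_num//.
by apply: le_measure; rewrite ?inE.
Qed.

Lemma fine_measureD_le (E F G : set T) : measurable E -> measurable F -> measurable G ->
  E `<=` G -> F `<=` G -> (forall w, E w -> F w -> False) ->
  fine (m E) + fine (m F) <= fine (m G).
Proof.
move=> mE mF mG EG FG dEF.
rewrite -fineD ?measure_fin_num// -measureU//; last first.
  by apply/seteqP; split => w //= -[] /dEF h /h.
by apply: fine_measure_le => //; [exact: measurableU | move=> w [/EG|/FG]].
Qed.

End RealMeasure.

Section TailAtInfinity.
Context {d : measure_display} {Omega : measurableType d} {R : realType}.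
Variable P : probability Omega R.

Lemma tail_cvg0 (X : Omega -> R) : measurable_fun setT X ->
  fine (P [set w | x < X w]) @[x --> +oo] --> (0 : R).
Proof.
move=> mX; pose X' : {RV P >-> R} := mfun_Sub (mem_set mX).
rewrite (_ : (fun x => _) = fine \o ccdf X').
  exact/fine_cvg/cvg_ccdfy0.
apply/funext => x; rewrite /= /ccdf /distribution /pushforward.
by congr (fine (P _)); apply/seteqP; split => w /=; rewrite in_itv /= andbT.
Qed.

End TailAtInfinity.

Section Independence.
Context {d : measure_display} {Omega : measurableType d} {R : realType}.
Variable P : probability Omega R.

(** By layers, the integral only involves the events that [Z] exceeds a level, and
    for those independence is the product rule. *)
Lemma integral_indep (E : set Omega) (Z : Omega -> R) : measurable E ->
    measurable_fun setT Z -> (forall w, 0 <= Z w) ->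
    (forall F : set R, measurable F -> P (E `&` Z @^-1` F) = (P E * P (Z @^-1` F))%E) ->
  (\int[P]_(w in E) (Z w)%:E = P E * \int[P]_w (Z w)%:E)%E.
Proof.
move=> mE mZ Z0 EZ.
have layers F : measurable F -> (\int[P]_(w in F) (Z w)%:E =
   \int[lebesgue_measure]_y P (F `&` Z @^-1` [set z | (0 < y < z)%R]))%E.
  move=> mF; have := integral_layers P mF (measurable_cst (0 : R)) mZ.
  by under eq_integral do rewrite subr0 max_r//.
have meas y : measurable [set z : R | 0 < y < z].
  rewrite [X in measurable X](_ : _ = if 0 < y then `]y, +oo[%classic else set0).
    by case: ifP.
  apply/seteqP; split => z /=; first by case/andP => -> yz; rewrite /= in_itv /= yz.
  by case: ifP => //=; rewrite in_itv /= andbT.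
rewrite layers// layers//.
under eq_integral do rewrite EZ//.
rewrite ge0_integralZl//=.
  by under [in RHS]eq_integral do rewrite setTI.
under eq_fun do rewrite -[_ @^-1` _]setTI.
exact: measurable_layers.
Qed.

End Independence.

(** * Subexponential tails *)

Section Tails.
Context {R : realType}.
Variable nu : probability R R.
Local Notation H := (tail_prob nu).

Let nu_fin : (nu setT < +oo)%E.
Proof. by rewrite probability_setT ltry. Qed.

Lemma tail_prob_ge0 x : 0 <= H x.
Proof. by rewrite /tail_prob fine_ge0. Qed.

Lemma tail_prob_le1 x : H x <= 1.
Proof.
rewrite -[leRHS]/(fine 1%E) -(probability_setT nu).
exact: fine_measure_le.
Qed.

Lemma tail_prob_nonincr x y : x <= y -> H y <= H x.
Proof.
move=> xy; apply: fine_measure_le => // z /=; rewrite !in_itv /= !andbT.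
exact: le_lt_trans.
Qed.

Lemma tail_probE x : nu `]x, +oo[%classic = (H x)%:E.
Proof. by rewrite /tail_prob fineK// measure_fin_num. Qed.

Lemma tail_prob_itv x y : x <= y -> nu `]x, y]%classic = (H x - H y)%:E.
Proof.
move=> xy.
have : nu `]x, +oo[%classic = (nu `]x, y]%classic + nu `]y, +oo[%classic)%E.
  rewrite -measureU//; last first.
    apply/seteqP; split => z //= []; rewrite !in_itv /= andbT => /andP[_ zy] yz.
    by have := le_lt_trans zy yz; rewrite ltxx.
  congr (nu _); apply/seteqP; split => z /=; rewrite !in_itv /= !andbT.
    by move=> ->; case: (leP z y) => h; [left|right].
  by move=> [/andP[]//|]; exact: le_lt_trans.
rewrite !tail_probE -[nu `]x, y]%classic]fineK ?measure_fin_num// -EFinD => -[->].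
by rewrite addrK.
Qed.

Lemma tail_prob_cvg0 : H x @[x --> +oo] --> (0 : R).
Proof.
rewrite (_ : tail_prob nu = fun x => fine (nu [set w | x < w])).
  exact: (tail_cvg0 nu (@measurable_id _ _ setT)).
apply/funext => x; congr (fine (nu _)).
by apply/seteqP; split => w /=; rewrite in_itv /= andbT.
Qed.

(** This event is the one that subexponentiality makes negligible: a sum of two
    independent copies becomes large through one of them only. *)
Definition both_large_tail (T x : R) : R :=
  fine ((nu \x nu)%E [set z : R * R | [/\ T < z.1, T < z.2 & x < z.1 + z.2]]).

Hypothesis nu_pos : nu `]0, +oo[%classic = 1%E.
Hypothesis subexp : subexponential nu.

Let Q : probability (R * R)%type R := (nu \x nu)%E.

Let Q_fin : (Q setT < +oo)%E.
Proof. by rewrite probability_setT ltry. Qed.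

Let Q_rect (E F : set R) : measurable E -> measurable F ->
  fine (Q (E `*` F)) = fine (nu E) * fine (nu F).
Proof. by move=> mE mF; rewrite /Q /= product_measure1E// fineM// measure_fin_num. Qed.

Let sum_tail x := fine (Q [set z | x < z.1 + z.2]).

Let sum_tail_cvg : sum_tail x / H x @[x --> +oo] --> (2 : R).
Proof. exact: subexp. Qed.

Lemma tail_prob0 : H 0 = 1.
Proof. by rewrite /tail_prob nu_pos. Qed.

(** If the tail vanished somewhere it would vanish from there on, and the quotient
    whose limit is [2] would eventually be [0]. *)
Lemma tail_prob_gt0 x : 0 < H x.
Proof.
rewrite lt_neqAle tail_prob_ge0 andbT eq_sym; apply/eqP => Hx0.
have /cvgrPdist_lt /(_ 1 ltr01) hy := sum_tail_cvg.
have [y [/= + xy]] := filter_ex (filterI hy (nbhs_pinfty_ge (num_real x))).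
have -> : H y = 0.
  by apply/eqP; rewrite eq_le tail_prob_ge0 andbT -Hx0 tail_prob_nonincr.
rewrite invr0 mulr0 subr0 normr_nat => h; lra.
Qed.

Let sum_tail_le e : 0 < e -> \forall x \near +oo, sum_tail x <= (2 + e) * H x.
Proof.
move=> e0; have /cvgrPdist_le /(_ e e0) := sum_tail_cvg.
apply: filterS => x; rewrite ler_norml => /andP[h _].
rewrite -ler_pdivrMr ?tail_prob_gt0//.
by lra.
Qed.

Let measurable_sum_gt x : measurable [set z : R * R | x < z.1 + z.2].
Proof. by apply: measurable_ltr_set; [exact: measurable_cst|exact: measurable_funD]. Qed.

Let Q_rays (x y : R) : fine (Q (`]x, +oo[ `*` `]y, +oo[)) = H x * H y.
Proof. by rewrite (Q_rect (measurable_itv _) (measurable_itv _)). Qed.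

Let Q_itv_ray (x y z : R) : x <= y -> fine (Q (`]x, y] `*` `]z, +oo[)) = (H x - H y) * H z.
Proof.
by move=> xy; rewrite (Q_rect (measurable_itv _) (measurable_itv _)) tail_prob_itv.
Qed.

Let Q_ray_itv (x y z : R) : x <= y -> fine (Q (`]z, +oo[ `*` `]x, y])) = H z * (H x - H y).
Proof.
by move=> xy; rewrite (Q_rect (measurable_itv _) (measurable_itv _)) tail_prob_itv.
Qed.

Let measurable_rect (i j : interval R) : measurable ([set` i] `*` [set` j] : set (R * R)).
Proof. by apply: measurableX; exact: measurable_itv. Qed.

(* The three terms come from disjoint ranges of the first entry: above [x], at most [T],
   and between the two. *)
Let sum_tail_ge_split T x : 0 <= T -> T <= x ->
  H x + (1 - H T) * H x + (H T - H x) * H (x - T) <= sum_tail x.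
Proof.
move=> T0 xT.
pose A1 : set (R * R) := `]x, +oo[ `*` `]0, +oo[.
pose A2 : set (R * R) := `]0, T] `*` `]x, +oo[.
pose A3 : set (R * R) := `]T, x] `*` `]x - T, +oo[.
have m1 : measurable A1 by exact: measurable_rect.
have m2 : measurable A2 by exact: measurable_rect.
have m3 : measurable A3 by exact: measurable_rect.
have m12 : measurable (A1 `|` A2) by exact: measurableU.
have s12 : fine (Q A1) + fine (Q A2) <= fine (Q (A1 `|` A2)).
  apply: (fine_measureD_le Q_fin m1 m2 m12) => //.
  move=> [a b] /= []; rewrite /= !in_itv /= => h1 _ [] /=.
  by rewrite !in_itv /= => h2 _; lra.
have s123 : fine (Q (A1 `|` A2)) + fine (Q A3) <= sum_tail x.
  apply: (fine_measureD_le Q_fin m12 m3 (measurable_sum_gt x)).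
  - by move=> [a b] /= [|] [] /=; rewrite !in_itv /= => h1 h2; lra.
  - by move=> [a b] /= []; rewrite /= !in_itv /= => h1 h2; lra.
  - by move=> [a b] /= [|] [] /=; rewrite !in_itv /= => h1 _ [];
      rewrite /= !in_itv /=; lra.
have q1 : fine (Q A1) = H x by rewrite Q_rays tail_prob0 mulr1.
have q2 : fine (Q A2) = (1 - H T) * H x by rewrite Q_itv_ray// tail_prob0.
have q3 : fine (Q A3) = (H T - H x) * H (x - T) by exact: Q_itv_ray.
rewrite -{1}q1 -q2 -q3; apply: le_trans s123.
by rewrite lerD2r.
Qed.

(* The three terms come from disjoint events: one of the entries is at most [T], so that the
   other one must exceed [x], or none of them is. *)
Let sum_tail_ge_both T x : 0 <= T -> T <= x ->
  2 * (1 - H T) * H x + both_large_tail T x <= sum_tail x.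
Proof.
move=> T0 xT.
pose A1 : set (R * R) := `]x, +oo[ `*` `]0, T].
pose A2 : set (R * R) := `]0, T] `*` `]x, +oo[.
pose A3 := [set z : R * R | [/\ T < z.1, T < z.2 & x < z.1 + z.2]].
have m1 : measurable A1 by exact: measurable_rect.
have m2 : measurable A2 by exact: measurable_rect.
have m12 : measurable (A1 `|` A2) by exact: measurableU.
have m3 : measurable A3.
  rewrite (_ : A3 = [set z : R * R | T < z.1] `&` ([set z : R * R | T < z.2] `&`
      [set z : R * R | x < z.1 + z.2])); last first.
    by apply/seteqP; split => z /=; [case|case=> ? []].
  by apply: measurableI; last apply: measurableI => //; exact: measurable_ltr_set.
have s12 : fine (Q A1) + fine (Q A2) <= fine (Q (A1 `|` A2)).
  apply: (fine_measureD_le Q_fin m1 m2 m12) => //.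
  move=> [a b] /= []; rewrite /= !in_itv /= => h1 _ [] /=.
  by rewrite !in_itv /= => h2 _; lra.
have s123 : fine (Q (A1 `|` A2)) + fine (Q A3) <= sum_tail x.
  apply: (fine_measureD_le Q_fin m12 m3 (measurable_sum_gt x)).
  - by move=> [a b] /= [|] [] /=; rewrite !in_itv /= => h1 h2; lra.
  - by move=> [a b] /= [].
  - by move=> [a b] /= [|] [] /=; rewrite !in_itv /= => h1 h2 [/=]; lra.
have q1 : fine (Q A1) = H x * (1 - H T) by rewrite Q_ray_itv// tail_prob0.
have q2 : fine (Q A2) = (1 - H T) * H x by rewrite Q_itv_ray// tail_prob0.
apply: le_trans s123; rewrite lerD2r; apply: le_trans s12.
by rewrite q1 q2 le_eqVlt; apply/orP; left; apply/eqP; ring.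
Qed.

Let long_tailed_arith (e hx hT h t : R) : 0 < e -> 0 < hx -> 0 < hT ->
    (1 + e) * hx <= e * hT / 2 -> hx + (1 - hT) * hx + (hT - hx) * h <= t ->
    t <= (2 + e * hT / 2) * hx ->
  h <= (1 + e) * hx.
Proof.
move=> e0 hx0 hT0 small ge le.
have ex : 0 < e * hx by rewrite mulr_gt0.
have eT : 0 < e * hT by rewrite mulr_gt0.
have d0 : 0 < hT - hx.
  have : (1 + e) * hx < (1 + e) * hT by lra.
  by rewrite ltr_pM2l; lra.
rewrite -(ler_pM2l d0); apply: (@le_trans _ _ ((hT + e * hT / 2) * hx)); first by lra.
rewrite mulrA ler_pM2r//; lra.
Qed.

(** When the first of two independent copies lies in [`]T, x]], a second one above
    [x - T] suffices for a sum above [x]. The pairs in which the second copy has to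
    exceed [x] alone, or the first one does, already account for [2 - H T] of the
    limit [2]; this leaves [H T] for the pairs just mentioned, whose share is about
    [H T * (H (x - T) / H x)]. *)
Lemma long_tailed T e : 0 <= T -> 0 < e ->
  \forall x \near +oo, H (x - T) <= (1 + e) * H x.
Proof.
move=> T0 e0.
have HT := tail_prob_gt0 T.
have d0 : 0 < e * H T / 2 by rewrite divr_gt0// mulr_gt0.
have c0 : 0 < e * H T / (2 * (1 + e)) by rewrite divr_gt0 ?mulr_gt0//; lra.
have /cvgrPdist_le /(_ _ c0) small := tail_prob_cvg0.
near=> x.
have xT : T <= x by near: x; apply: nbhs_pinfty_ge; rewrite num_real.
have hs : sum_tail x <= (2 + e * H T / 2) * H x by near: x; exact: sum_tail_le.
have hx : H x <= e * H T / (2 * (1 + e)).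
  rewrite -[leLHS]ger0_norm ?tail_prob_ge0// -normrN -sub0r.
  by near: x.
apply: (long_tailed_arith e0 (tail_prob_gt0 x) HT _ (sum_tail_ge_split T0 xT) hs).
rewrite mulrC -ler_pdivlMr; last by rewrite addr_gt0.
by apply: (le_trans hx); rewrite invfM mulrA.
Unshelve. all: by end_near.
Qed.

(** The pairs with one entry at most [T] account for [2 * (1 - H T)] of the limit [2]
    in the definition of subexponentiality, hence [2 * H T] is left for the others. *)
Lemma both_large_small e : 0 < e -> exists2 T, 0 <= T &
  \forall x \near +oo, both_large_tail T x <= e * H x.
Proof.
move=> e0.
have e4 : 0 < e / 4 by rewrite divr_gt0.
have /cvgrPdist_le /(_ _ e4) small := tail_prob_cvg0.
have [T [/= hT T0]] := filter_ex (filterI small (nbhs_pinfty_ge (num_real 0))).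
exists T => //; near=> x.
have xT : T <= x by near: x; apply: nbhs_pinfty_ge; rewrite num_real.
have hs : sum_tail x <= (2 + e / 2) * H x.
  by near: x; apply: sum_tail_le; rewrite divr_gt0.
rewrite sub0r normrN ger0_norm ?tail_prob_ge0// in hT.
have hTx : H T * H x <= e / 4 * H x by rewrite ler_wpM2r ?tail_prob_ge0.
have := le_trans (sum_tail_ge_both T0 xT) hs; lra.
Unshelve. all: by end_near.
Qed.

End Tails.

(** * Asymptotic consequences of a tail inequality *)

(** The step, applied at each point of [[0, Z]] with [l] the supremum of [g] over
    [[0, Z]], bounds this supremum by [theta * (1 + l)] unless it is attained
    before [Z0]; as [theta < 1], the bound does not depend on [Z]. *)
Lemma self_bounded {R : realType} (g : R -> R) (theta Z0 : R) :
    0 <= theta < 1 -> (forall y, 0 <= g y) ->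
    (forall Z, exists M, forall y, y <= Z -> g y <= M) ->
    (forall Z l, Z0 <= Z -> (forall y, 0 <= y <= Z -> g y <= l) ->
       g Z <= theta * (1 + l)) ->
  exists2 l, 0 <= l & forall y, 0 <= y -> g y <= l.
Proof.
move=> /andP[th0 th1] g0 loc step.
have [M0 hM0] := loc Z0.
pose ls := Num.max (Num.max 0 M0) (theta / (1 - theta)).
exists ls; first by rewrite /ls !le_max lexx.
move=> Z Z_ge0.
pose E := [set g y | y in [set y | 0 <= y <= Z]].
have supE : has_sup E.
  split; first by exists (g 0); exists 0 => //=; rewrite lexx.
  have [M hM] := loc Z; exists M => _ [y /andP[_ yZ] <-]; exact: hM.
set l := sup E.
have le_l y : 0 <= y <= Z -> g y <= l.
  by move=> hy; apply: ub_le_sup; [exact: supE.2|exists y].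
have : l <= Num.max (Num.max 0 M0) (theta * (1 + l)).
  apply: ge_sup; first exact: supE.1.
  move=> _ [y /andP[y0 yZ] <-]; case: (leP y Z0) => yZ0.
    by rewrite !le_max hM0 ?orbT.
  rewrite le_max step ?orbT ?ltW// => u /andP[u0 uy].
  by apply: le_l; rewrite u0 (le_trans uy).
rewrite le_max => /orP[h|h].
  apply: (le_trans (le_l Z _)); first by rewrite Z_ge0 lexx.
  by rewrite /ls le_max h.
apply: (le_trans (le_l Z _)); first by rewrite Z_ge0 lexx.
by rewrite /ls le_max; apply/orP; right; rewrite ler_pdivlMr ?subr_gt0//; lra.
Qed.

(** In this section [f] is the tail of a stationary backlog, [H] that of the residual
    size, [al] and [b] are the means of an interarrival time and of the size, and
    [D] is the tail of a pair of large residual sizes. *)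
Section TailInequality.
Context {R : realType}.
Variables (H f : R -> R) (D : R -> R -> R) (al b : R).
Hypothesis H_gt0 : forall x, 0 < H x.
Hypothesis H_nonincr : forall x y, x <= y -> H y <= H x.
Hypothesis H_long : forall T e, 0 <= T -> 0 < e ->
  \forall x \near +oo, H (x - T) <= (1 + e) * H x.
Hypothesis D_small : forall e, 0 < e -> exists2 T, 0 <= T &
  \forall x \near +oo, D T x <= e * H x.
Hypothesis f_ge0 : forall x, 0 <= f x.
Hypothesis f_le1 : forall x, f x <= 1.
Hypothesis b_gt0 : 0 < b.
Hypothesis b_lt : b < al.
Hypothesis f_step : forall e, 0 < e -> exists2 L, 0 <= L &
  forall T x l, 0 <= T -> 2 * T <= x -> 0 <= l ->
    (forall y, 0 <= y <= x -> f y <= l * H y) ->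
  (al - e) * f (x + L) <= b * (H (x - T) + l * D T x + f (x - T)).

Let g x := f x / H x.

Let g_ge0 x : 0 <= g x.
Proof. by rewrite divr_ge0// ltW. Qed.

Let gM x : g x * H x = f x.
Proof. by rewrite /g divfK// gt_eqF. Qed.

(* One application of [f_step], written at [Z = x + L]. *)
Let g_step e : 0 < e -> e < al -> exists2 C, 0 <= C &
  \forall Z \near +oo, forall l l',
    (forall y, 0 <= y <= Z -> g y <= l) -> g (Z - C) <= l' ->
    (al - e) * g Z <= b * (1 + e) * (1 + e * l + l').
Proof.
move=> e0 eal.
have [L L0 hL] := f_step e0.
have [T T0 hT] := D_small e0.
have C0 : 0 <= L + T by rewrite addr_ge0.
exists (L + T) => //.
have [N [_ hN]] := hT.
have hlong := H_long C0 e0.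
near=> Z => l l' gl gl'.
have Z1 : L + 2 * T <= Z by near: Z; apply: nbhs_pinfty_ge; rewrite num_real.
have Z2 : N + L + 1 <= Z by near: Z; apply: nbhs_pinfty_ge; rewrite num_real.
have Dx : D T (Z - L) <= e * H (Z - L) by apply: hN; lra.
have Hx : H (Z - (L + T)) <= (1 + e) * H Z by near: Z.
have Hx' : H (Z - L) <= H (Z - (L + T)) by apply: H_nonincr; lra.
have l0 : 0 <= l by apply: le_trans (gl Z _); rewrite ?g_ge0 ?lexx//; lra.
have ZT : 2 * T <= Z - L by lra.
have fl y : 0 <= y <= Z - L -> f y <= l * H y.
  move=> /andP[y0 yZ]; rewrite -gM ler_pM2r//; apply: gl; rewrite y0; lra.
have := hL T (Z - L) l T0 ZT l0 fl; rewrite subrK.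
rewrite (_ : Z - L - T = Z - (L + T)); last by lra.
rewrite -[f (_ - _)]gM -[f Z]gM => h.
rewrite -(ler_pM2r (H_gt0 Z)).
have HZ := H_gt0 Z.
have HC := H_gt0 (Z - (L + T)).
have : l * D T (Z - L) <= l * (e * H (Z - (L + T))).
  by apply: ler_wpM2l => //; apply: (le_trans Dx); rewrite ler_pM2l.
have : g (Z - (L + T)) * H (Z - (L + T)) <= l' * H (Z - (L + T)) by rewrite ler_pM2r.
have l'0 : 0 <= l' by exact: le_trans gl'.
have : (1 + e * l + l') * H (Z - (L + T)) <= (1 + e * l + l') * ((1 + e) * H Z).
  by rewrite ler_wpM2l// !addr_ge0// mulr_ge0// ltW.
move=> h1 h2 h3.
rewrite -[_ * g Z * H Z]mulrA; apply: (le_trans h).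
rewrite [X in _ <= X](_ : _ = b * ((1 + e * l + l') * ((1 + e) * H Z))); last by ring.
rewrite ler_pM2l//.
apply: le_trans h1; lra.
Unshelve. all: by end_near.
Qed.

(** For [e] small, [g_step] with [l' = l] bounds [g Z] by [theta * (1 + l)], where
    [theta] is close to [b / al < 1]; hence [self_bounded] applies. *)
Lemma tail_ratio_bounded : exists2 l, 0 <= l & forall x, 0 <= x -> f x <= l * H x.
Proof.
have al0 : 0 < al by exact: lt_trans b_lt.
have [bp ba] : 0 < b /\ b < al by [].
have b3 : 0 < 1 + 3 * b by lra.
(* [e] is small enough for [b * (1 + e) ^+ 2 < al - e] *)
have [e [e0 e1 e2]] : exists e, [/\ 0 < e, e <= 1 & e * (1 + 3 * b) <= (al - b) / 2].
  exists (Num.min 1 ((al - b) / 2 / (1 + 3 * b))); split.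
  - by rewrite lt_min ltr01 !divr_gt0// subr_gt0.
  - by rewrite ge_min lexx.
  - by rewrite -ler_pdivlMr// ge_min lexx orbT.
have eb : 0 < e * b by rewrite mulr_gt0.
have eal : e < al by lra.
have [C C0 [N [_ hN]]] := g_step e0 eal.
have [l l0 hl] : exists2 l, 0 <= l & forall y, 0 <= y -> g y <= l.
  pose th := b * (1 + 3 * e) / (al - e).
  have th01 : 0 <= th < 1.
    apply/andP; split; first by rewrite divr_ge0//; nra.
    by rewrite ltr_pdivrMr ?mul1r; nra.
  apply: (@self_bounded _ g th (Num.max C (N + 1))) => //.
    move=> Z; exists (H Z)^-1 => y yZ; rewrite /g ler_pdivrMr//.
    rewrite mulrC; apply: (le_trans (f_le1 _)).
    by rewrite ler_pdivlMr// mul1r H_nonincr.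
  move=> Z l; rewrite ge_max => /andP[CZ NZ] gl.
  have l0 : 0 <= l by apply: le_trans (gl Z _); rewrite ?g_ge0 ?lexx// andbT; lra.
  have NZ' : N < Z by lra.
  have glC : g (Z - C) <= l by apply: gl; lra.
  have := hN Z NZ' l l gl glC; rewrite -ler_pdivlMl; last by lra.
  move=> /le_trans; apply; rewrite mulrC [leRHS]mulrAC ler_wpM2r//.
    by rewrite invr_ge0; lra.
  rewrite -!mulrA ler_pM2l//.
  have ee : e * e <= e by nra.
  have eel : e * e * l <= e * l by rewrite ler_wpM2r.
  nra.
by exists l => // x x0; rewrite -gM ler_pM2r// hl.
Qed.

(** Writing [lam] for the limit superior of [f / H], the step inequality becomes
    [al * lam <= b * (1 + lam)], that is [lam <= b / (al - b)]. Boundedness is needed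
    first: it makes [lam] finite and removes the term with [D]. *)
Lemma tail_ratio_limsup dl : 0 < dl ->
  \forall x \near +oo, f x <= (b / (al - b) + dl) * H x.
Proof.
move=> dl0.
have [l l0 hl] := tail_ratio_bounded.
have gl y : 0 <= y -> g y <= l by move=> y0; rewrite ler_pdivrMr// hl.
pose S := [set s : R | \forall x \near +oo, g x <= s].
have Sl : S l.
  by near=> x; apply: gl; near: x; apply: nbhs_pinfty_ge; rewrite num_real.
have S0 : lbound S 0.
  by move=> s hs; have [x /(le_trans (g_ge0 _))] := filter_ex hs.
have infS : has_inf S by split; [exists l|exists 0].
set lam := inf S.
have lam0 : 0 <= lam by apply: lb_le_inf => //; exists l.
have lamE e : 0 < e -> \forall x \near +oo, g x <= lam + e.
  move=> e0; have [s hs sl] := inf_adherent e0 infS.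
  by apply: filterS hs => x /le_trans; apply; exact: ltW.
suff : lam <= b / (al - b).
  move=> lamb; apply: filterS (lamE _ dl0) => x gx.
  by rewrite -gM ler_pM2r// (le_trans gx)// lerD2r.
rewrite leNgt; apply/negP; rewrite ltr_pdivrMr ?subr_gt0// => hlam.
have al0 : 0 < al by exact: lt_trans b_lt.
have [bp ba] : 0 < b /\ b < al by [].
(* were [lam] larger, some [e > 0] would still leave room in the step inequality *)
set M := b * (1 + lam + 2 * (l + 1)).
have M0 : 0 < M by rewrite /M mulr_gt0//; lra.
have lamM : 0 < 2 * (lam + M) by lra.
have G0 : 0 < lam * (al - b) - b by lra.
have [e [e0 e1 eal eA]] : exists e, [/\ 0 < e, e <= 1, e <= al / 2 &
    e * (2 * (lam + M)) <= lam * (al - b) - b].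
  exists (Num.min (Num.min 1 (al / 2)) ((lam * (al - b) - b) / (2 * (lam + M)))).
  split.
  - by rewrite !lt_min ltr01 !divr_gt0.
  - by rewrite !ge_min lexx.
  - by rewrite !ge_min lexx ?orbT.
  - by rewrite -ler_pdivlMr// ge_min lexx orbT.
have e_lt : e < al by lra.
have [C C0 hC] := g_step e0 e_lt.
have : S (b * (1 + e) * (1 + e * l + (lam + e)) / (al - e)).
  have [N [_ hN]] := lamE _ e0.
  near=> x.
  rewrite ler_pdivlMr; last by lra.
  rewrite mulrC.
  have hx : forall l l', (forall y, 0 <= y <= x -> g y <= l) -> g (x - C) <= l' ->
    (al - e) * g x <= b * (1 + e) * (1 + e * l + l') by near: x.
  apply: hx; first by move=> y /andP[y0 _]; exact: gl.
  apply: hN; suff: N + C + 1 <= x by lra.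
  by near: x; apply: nbhs_pinfty_ge; rewrite num_real.
move=> /(ge_inf infS.2); rewrite -/lam ler_pdivlMr; last by lra.
have ee : e * e <= e by nra.
have : b * (1 + e) * (1 + e * l + (lam + e)) <=
  b * (1 + lam) + e * M.
  rewrite -subr_ge0 /M.
  rewrite [X in 0 <= X](_ : _ = b * (l + 1) * (e - e * e)); last by ring.
  by rewrite mulr_ge0 ?subr_ge0// mulr_ge0 ?ltW//; lra.
have elam : 0 <= e * lam by rewrite mulr_ge0// ltW.
have eM : 0 < e * M by rewrite mulr_gt0.
lra.
Unshelve. all: by end_near.
Qed.

End TailInequality.

(** As [f] vanishes and [p] tends to [1], a large fixed [T] makes the left-hand side
    nearly [c * H (x + T)], and [H (x + T)] is nearly [H x] because [H] is
    long-tailed. *)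
Lemma lower_limit {R : realType} (H f p : R -> R) (al c dl : R) :
    (forall x, 0 < H x) ->
    (forall T e, 0 <= T -> 0 < e -> \forall x \near +oo, H (x - T) <= (1 + e) * H x) ->
    f x @[x --> +oo] --> (0 : R) -> p T @[T --> +oo] --> (1 : R) ->
    (forall T, p T <= 1) -> (forall x, 0 <= f x) ->
    0 < c -> c < al -> 0 < dl ->
    (forall x T, 0 <= x -> 0 <= T ->
      (1 - f x) * p T * (c * H (x + T)) <= (al - c) * f x) ->
  \forall x \near +oo, (c / (al - c) - dl) * H x <= f x.
Proof.
move=> H0 Hlong f0 p1 p_le1 f_ge0 c0 cal dl0 step.
have alc : 0 < al - c by rewrite subr_gt0.
(* [3 * e] bounds the relative loss in [(1 - e) ^+ 2 / (1 + e)] *)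
have [e [e0 e1 ed]] : exists e, [/\ 0 < e, e <= 1 / 2 & 3 * e * c <= dl * (al - c)].
  exists (Num.min (1 / 2) (dl * (al - c) / (3 * c))); split.
  - by rewrite lt_min !divr_gt0// ?mulr_gt0.
  - by rewrite ge_min lexx.
  - rewrite mulrAC mulrC -ler_pdivlMr; last by rewrite mulr_gt0.
    by rewrite ge_min lexx orbT.
have /cvgrPdist_le /(_ e e0) hp := p1.
have [T [/= pT T0]] := filter_ex (filterI hp (nbhs_pinfty_ge (num_real 0))).
have {}pT : 1 - e <= p T by move: pT; rewrite ler_norml => /andP[]; lra.
have /cvgrPdist_le /(_ e e0) hf := f0.
have [N [_ hN]] := Hlong T e T0 e0.
near=> x.
have x0 : 0 <= x by near: x; apply: nbhs_pinfty_ge; rewrite num_real.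
have Nx : N < x by near: x; apply: nbhs_pinfty_gt; rewrite num_real.
have fx : `|0 - f x| <= e by near: x.
have {}fx : f x <= e by move: fx; rewrite sub0r normrN ger0_norm.
have hH : H x <= (1 + e) * H (x + T) by have := hN (x + T); rewrite addrK; apply; lra.
have := step x T x0 T0.
have HxT := H0 (x + T); have Hx := H0 x.
have h1 : (1 - e) * (1 - e) <= (1 - f x) * p T by apply: ler_pM; lra.
have h2 : (1 - e) * (1 - e) * (c * H (x + T)) <= (1 - f x) * p T * (c * H (x + T)).
  by rewrite ler_wpM2r// mulr_ge0// ltW.
move=> /(le_trans h2) h3.
have h4 : (1 - 3 * e) * c * H x <= (al - c) * f x.
  have ce : 0 < c * H (x + T) by rewrite mulr_gt0.
  have [h5|h5] := leP (1 - 3 * e) 0.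
    apply: (@le_trans _ _ 0); last by rewrite mulr_ge0// ltW.
    by rewrite -mulrA mulr_le0_ge0// mulr_ge0// ltW.
  apply: le_trans h3.
  apply: (@le_trans _ _ ((1 - 3 * e) * c * ((1 + e) * H (x + T)))).
    by rewrite ler_pM2l// mulr_gt0.
  rewrite [leLHS](_ : _ = (1 - 3 * e) * (1 + e) * (c * H (x + T))); last by ring.
  rewrite ler_pM2r//; nra.
rewrite -(ler_pM2l alc); apply: le_trans h4.
rewrite mulrA ler_pM2r// mulrBr [_ * (c / _)]mulrC divfK ?gt_eqF//.
lra.
Unshelve. all: by end_near.
Qed.

(** The error is the negative part of [p x / (C * H x) - 1]. *)
Lemma lower_asymptotics {R : realType} (H p : R -> R) (C : R) : 0 < C ->
    (forall x, 0 < H x) ->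
    (forall dl, 0 < dl -> \forall x \near +oo, (C - dl) * H x <= p x) ->
  exists2 eps : R -> R, eps x @[x --> +oo] --> (0 : R) &
    forall x, (1 + eps x) * C * H x <= p x.
Proof.
move=> C0 H0 h; exists (fun x => Num.min 0 (p x / (C * H x) - 1)).
  apply/cvgrPdist_le => e e0.
  have := h (e * C) (mulr_gt0 e0 C0); apply: filterS => x hx.
  rewrite sub0r normrN ler0_norm ?ge_min ?lexx// lerNl le_min; apply/andP; split.
    by rewrite oppr_le0 ltW.
  rewrite lerBrDl ler_pdivlMr ?mulr_gt0//; apply: le_trans hx.
  by rewrite mulrA mulrBl mul1r.
move=> x; rewrite -mulrA -ler_pdivlMr ?mulr_gt0//.
by rewrite -lerBrDl ge_min lexx orbT.
Qed.

(** The error is the positive part of [p x / (C * H x) - 1]. *)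
Lemma upper_asymptotics {R : realType} (H p : R -> R) (C : R) : 0 < C ->
    (forall x, 0 < H x) ->
    (forall dl, 0 < dl -> \forall x \near +oo, p x <= (C + dl) * H x) ->
  exists2 eps : R -> R, eps x @[x --> +oo] --> (0 : R) &
    forall x, p x <= (1 + eps x) * C * H x.
Proof.
move=> C0 H0 h; exists (fun x => Num.max 0 (p x / (C * H x) - 1)).
  apply/cvgrPdist_le => e e0.
  have := h (e * C) (mulr_gt0 e0 C0); apply: filterS => x hx.
  rewrite sub0r normrN ger0_norm ?le_max ?lexx// ge_max (ltW e0)/=.
  rewrite lerBlDl ler_pdivrMr ?mulr_gt0//; apply: (le_trans hx).
  by rewrite le_eqVlt; apply/orP; left; apply/eqP; ring.
move=> x; rewrite -mulrA -ler_pdivrMr ?mulr_gt0//.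
by rewrite -lerBlDl le_max lexx orbT.
Qed.

(** * Tools for one step of the waiting time recursion *)

Section Integrals.
Context {d : measure_display} {Omega : measurableType d} {R : realType}.
Variable P : probability Omega R.

Lemma integral_indic_mul (E : set Omega) (Z : Omega -> R) : measurable E ->
  (\int[P]_w (\1_E w * Z w)%:E = \int[P]_(w in E) (Z w)%:E)%E.
Proof.
move=> mE; rewrite [RHS]integral_mkcond; apply: eq_integral => w _.
rewrite patchE indicE; case: ifP => _; first by rewrite mul1r.
by rewrite mul0r.
Qed.

Lemma min_mean_ge (A : Omega -> R) (al e : R) : measurable_fun setT A ->
    (forall w, 0 <= A w) -> (\int[P]_w (A w)%:E)%E = al%:E -> 0 < e ->
  exists2 L, 0 <= L & ((al - e)%:E <= \int[P]_w (Num.min (A w) L)%:E)%E.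
Proof.
move=> mA A0 Aal e0.
pose g n w := (Num.min (A w) n%:R)%:E.
have mg n : measurable_fun setT (g n).
  by apply/measurable_EFinP; apply: measurable_minr => //.
have g0 n w : setT w -> (0 <= g n w)%E.
  by move=> _; rewrite lee_fin le_min A0 ler0n.
have gn w : setT w -> nondecreasing_seq (g ^~ w).
  move=> _ m n mn; rewrite lee_fin le_min ge_min lexx /=.
  by rewrite ge_min ler_nat mn orbT.
have := @cvg_monotone_convergence _ _ _ P setT measurableT g mg g0 gn.
have -> : (fun w => limn (g ^~ w)) = EFin \o A.
  apply/funext => w; apply/cvg_lim => //; apply/cvg_EFin; first by near=> n.
  apply: cvg_near_cst; near=> n; rewrite /= min_l//.
  near: n; exact: nbhs_infty_ger.
rewrite [X in _ --> X]Aal => cv.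
have nd : nondecreasing_seq (fun n => \int[P]_w g n w)%E.
  move=> m n mn; apply: ge0_le_integral => //; first by move=> w _; exact: g0.
  by move=> w _; exact: gn.
have := lte_lim nd (cvgP _ cv) (_ : ((al - e)%:E < _)%E); rewrite (cvg_lim _ cv)//.
move=> /(_ _)/filter_ex[|n hn]; first by rewrite lte_fin ltrBlDr ltrDl.
by exists n%:R.
Unshelve. all: by end_near.
Qed.

End Integrals.

Section Overlap.
Context {d : measure_display} {Omega : measurableType d} {R : realType}.
Variables (P : probability Omega R) (nu : probability R R) (B : Omega -> R) (b : R).
Local Notation H := (tail_prob nu).
Hypothesis mB : measurable_fun setT B.
Hypothesis b_ge0 : 0 <= b.
Hypothesis B_tail : forall x, 0 <= x ->
  (\int[lebesgue_measure]_(y in `]x, +oo[) P [set w | (y < B w)%R] = (b * H x)%:E)%E.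

(** The law of the residual size has the density [P [set w | y < B w] / b]; integrating
    the tail of one residual size against it gives the tail of a pair. Only Tonelli
    and the tail of [nu] are used, so the density itself need not be identified. *)
Lemma both_large_tailE (T x : R) : 0 <= T ->
  (\int[lebesgue_measure]_(y in `]T, +oo[)
     ((H (Num.max T (x - y)))%:E * P [set w | (y < B w)%R]) =
   (b * both_large_tail nu T x)%:E)%E.
Proof.
move=> T0.
have nu_itv u : (H u)%:E = nu `]u, +oo[%classic by rewrite tail_probE.
pose W := [set z : R * measurableTypeR R | [/\ T < z.1, T < z.2 & x < z.1 + z.2]].
pose pB (y : measurableTypeR R) := P (setT `&` [set w | 0 < y < B w]).
have pBE y : T < y -> pB y = P [set w | (y < B w)%R].
  move=> Ty; congr (P _); apply/seteqP; split => w /=; first by case=> _ /andP[].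
  by move=> ->; split => //; rewrite andbT (le_lt_trans T0).
pose g z := ((\1_W z)%:E * pB z.2)%E.
have mW : measurable W.
  rewrite (_ : W = [set z | T < z.1] `&` ([set z | T < z.2] `&`
      [set z | x < z.1 + z.2])); last first.
    by apply/seteqP; split => z /=; [case|case=> ? []].
  by apply: measurableI; last apply: measurableI => //; apply: measurable_ltr_set => //;
    exact: measurable_funD.
have mpB : measurable_fun setT pB by exact: measurable_layers.
have pB0 y : (0 <= pB y)%E by [].
have mg : measurable_fun setT g.
  apply: emeasurable_funM; first by apply/measurable_EFinP; exact: measurable_indic.
  exact: measurableT_comp mpB measurable_snd.
have g0 z : (0 <= g z)%E by rewrite mule_ge0// lee_fin.
have WE u y : W (u, y) <-> T < u /\ Num.max T (x - u) < y.
  rewrite gt_max ltrBlDr addrC; split; first by case=> /= -> -> ->.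
  by case=> ? /andP[].
have inner_y u : (\int[lebesgue_measure]_y g (u, y) = b%:E * nu (xsection W u))%E.
  have [Tu|uT] := ltP T u; last first.
    rewrite (_ : xsection W u = set0); last first.
      by apply/seteqP; split => y //; rewrite /xsection /= inE => -[/=]; lra.
    rewrite measure0 mule0 integral0_eq// => y _; rewrite /g indicE memNset ?mul0e//.
    by case=> /=; lra.
  have -> : xsection W u = `]Num.max T (x - u), +oo[%classic.
    apply/seteqP; split => y; rewrite /xsection /= inE WE in_itv /= andbT.
      by case.
    by [].
  rewrite -nu_itv -EFinM -B_tail ?le_max ?T0//.
  rewrite [RHS]integral_mkcond; apply: eq_integral => y _.
  rewrite patchE /g indicE; case: ifPn => [|/negP hy].
    rewrite inE /= in_itv /= andbT => hy.
    by rewrite mem_set ?mul1e ?pBE//; [move: hy; rewrite gt_max => /andP[]|exact/WE].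
  by rewrite memNset ?mul0e// WE => -[_ ?]; apply: hy; rewrite inE /= in_itv /= andbT.
transitivity (\int[lebesgue_measure]_y \int[nu]_u g (u, y))%E.
  rewrite [LHS]integral_mkcond; apply: eq_integral => y _.
  under [RHS]eq_integral do rewrite /g muleC /=.
  rewrite ge0_integralZl//; last first.
    apply/measurable_EFinP; exact: (measurableT_comp (measurable_indic mW)).
  rewrite patchE; case: ifPn => [|/negP hy].
    rewrite inE /= in_itv /= andbT => hy.
    rewrite pBE// muleC; congr (_ * _)%E.
    rewrite nu_itv (_ : `]_, +oo[%classic = ysection W y).
      rewrite -(setIT (ysection W y)) -integral_indic//; last exact: measurable_ysection.
      apply: eq_integral => u _; rewrite !indicE; congr (_%:R%:E).
      by rewrite mem_ysection.
    apply/seteqP; split => u; rewrite /ysection /= inE in_itv /= andbT gt_max.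
      by move=> /andP[? ?]; split => //=; rewrite -ltrBlDr.
    by case=> /= ? ? ?; apply/andP; split => //; rewrite ltrBlDr.
  rewrite integral0_eq ?mule0// => u _; rewrite indicE memNset//.
  by case=> /= _ ? _; apply: hy; rewrite inE /= in_itv /= andbT.
rewrite -(fubini_tonelli g)//.
under eq_integral do rewrite inner_y.
rewrite ge0_integralZl//; last first.
  exact: (measurable_fun_xsection nu (mW : measurable (W : set (R * R)))).
rewrite EFinM; congr (_ * _)%E.
have Qfin : ((nu \x nu)%E setT < +oo)%E.
  by have := probability_setT (nu \x nu)%E; rewrite /= => ->; rewrite ltry.
rewrite /both_large_tail fineK//; exact: (measure_fin_num Qfin).
Qed.

End Overlap.

Section CappedMeans.
Context {d : measure_display} {Omega : measurableType d} {R : realType}.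
Variable P : probability Omega R.

Definition indep_rv (X Y : Omega -> R) := forall E F : set R,
  measurable E -> measurable F ->
  P (X @^-1` E `&` Y @^-1` F) = (P (X @^-1` E) * P (Y @^-1` F))%E.

Lemma prob_lty : (P setT < +oo)%E.
Proof. by rewrite probability_setT ltry. Qed.

Lemma probE (E : set Omega) : measurable E -> P E = (fine (P E))%:E.
Proof. by move=> mE; rewrite fineK// (measure_fin_num prob_lty). Qed.

Lemma measurable_preimage (X : Omega -> R) (E : set R) :
  measurable_fun setT X -> measurable E -> measurable (X @^-1` E).
Proof. by move=> mX mE; rewrite -[X in measurable X]setTI; exact: mX. Qed.

Lemma ge0_integralD_real (X Y : Omega -> R) :
  measurable_fun setT X -> measurable_fun setT Y ->
  (forall w, 0 <= X w) -> (forall w, 0 <= Y w) ->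
  (\int[P]_w (X w + Y w)%:E = \int[P]_w (X w)%:E + \int[P]_w (Y w)%:E)%E.
Proof.
move=> mX mY X0 Y0; under eq_integral do rewrite EFinD.
by rewrite ge0_integralD//; [move=> w _; rewrite lee_fin|exact/measurable_EFinP|
  move=> w _; rewrite lee_fin|exact/measurable_EFinP].
Qed.

Lemma integral_excess (B : Omega -> R) (x : R) : measurable_fun setT B ->
  (\int[P]_w (Num.max 0 (B w - x))%:E =
   \int[lebesgue_measure]_(y in `]x, +oo[) P [set w | (y < B w)%R])%E.
Proof.
move=> mB; rewrite (integral_layers P measurableT (measurable_cst x) mB).
rewrite [RHS]integral_mkcond; apply: eq_integral => y _; rewrite patchE setTI.
case: ifPn => [|/negP]; rewrite inE /= in_itv /= andbT => xy.
  by congr (P _); apply/seteqP; split => w /=; rewrite xy.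
rewrite (_ : [set w | _] = set0) ?measure0//.
by apply/seteqP; split => w //= /andP[].
Qed.

Lemma integral_indep_rv (X Z : Omega -> R) (E : set R) :
  measurable_fun setT X -> measurable_fun setT Z -> (forall w, 0 <= Z w) ->
  indep_rv X Z -> measurable E ->
  (\int[P]_(w in X @^-1` E) (Z w)%:E = P (X @^-1` E) * \int[P]_w (Z w)%:E)%E.
Proof.
move=> mX mZ Z0 XZ mE; apply: integral_indep => //.
- exact: measurable_preimage.
- by move=> F mF; exact: XZ.
Qed.

Lemma indep_rv_comp (X Z : Omega -> R) (h : R -> R) : measurable_fun setT h ->
  indep_rv X Z -> indep_rv X (h \o Z).
Proof.
move=> mh XZ E F mE mF; rewrite comp_preimage; apply: XZ => //.
by rewrite -[X in measurable X]setTI; exact: mh.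
Qed.

(** The cap [K] makes the mean finite, so that the equal means of a stationary
    variable at two consecutive times cancel. *)
Lemma integral_capped (M : Omega -> R) (x K : R) : measurable_fun setT M ->
  (\int[P]_w (Num.max 0 (Num.min (M w) K - x))%:E =
   \int[lebesgue_measure]_(y in `]x, K[) P [set w | (y < M w)%R])%E.
Proof.
move=> mM; rewrite (integral_layers P measurableT (measurable_cst x)
  (measurable_minr mM (measurable_cst K))).
rewrite [RHS]integral_mkcond; apply: eq_integral => y _; rewrite patchE setTI.
case: ifPn => [|/negP]; rewrite inE /= in_itv /= => xy.
  by congr (P _); apply/seteqP; split => w /=; case/andP: xy => -> yK; rewrite lt_min yK andbT.
rewrite (_ : [set w | _] = set0) ?measure0//.
by apply/seteqP; split => w //= /andP[? ]; rewrite lt_min => /andP[? ?]; apply: xy; apply/andP.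
Qed.

Lemma integral_capped_fin (M : Omega -> R) (x K : R) : measurable_fun setT M ->
  (\int[P]_w (Num.max 0 (Num.min (M w) K - x))%:E)%E \is a fin_num.
Proof.
move=> mM; rewrite ge0_fin_numE; last first.
  by apply: integral_ge0 => w _; rewrite lee_fin le_max lexx.
apply: (@le_lt_trans _ _ (\int[P]_w (cst (Num.max 0 (K - x))%:E w))%E).
  apply: ge0_le_integral => //.
  - by move=> w _; rewrite lee_fin le_max lexx.
  - apply/measurable_EFinP; apply: measurable_maxr => //.
    by apply: measurable_funB => //; exact: measurable_minr.
  - move=> w _ /=; rewrite lee_fin ge_max !le_max lexx /=.
    by rewrite lerD2r ge_min lexx !orbT.
rewrite integral_cst//; apply: lte_mul_pinfty => //; last exact: prob_lty.
by rewrite lee_fin le_max lexx.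
Qed.

Lemma measurable_between (X Y : Omega -> R) y : measurable_fun setT X ->
  measurable_fun setT Y -> measurable [set w | X w < y < Y w].
Proof.
move=> mX mY; rewrite (_ : mkset _ = [set w | X w < y] `&` [set w | y < Y w]).
  by apply: measurableI; exact: measurable_ltr_set.
by apply/seteqP; split => w /=; [case/andP|case=> -> ->].
Qed.

Lemma measurable_tail (X : Omega -> R) : measurable_fun setT X ->
  measurable_fun setT (fun y : R => P [set w | y < X w]).
Proof.
move=> mX; rewrite (_ : (fun y => _) = EFin \o (fun y => fine (P [set w | y < X w]))).
  apply/measurable_EFinP; apply: nonincreasing_measurable => // y z yz.
  apply: (fine_measure_le prob_lty); [exact: measurable_ltr_set..|].
  by move=> w /=; exact: le_lt_trans.
by apply/funext => y /=; rewrite -probE//; exact: measurable_ltr_set.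
Qed.

End CappedMeans.

(** The excess over [x] after an arrival, capped at [K - x], against the one before.
    A backlog [m] above [x + L] loses at least [Num.min a L] and gains at most [b]; one
    between [x - T] and [x + L] gains at most [b]; from a smaller one, the level
    [x] is passed only by what [b] exceeds [x - m]. *)
Lemma lindley_step_le {R : realType} (m m1 a b x T L K : R) :
    0 <= a -> 0 <= b -> 0 <= T -> 2 * T <= x -> 0 <= L -> x + L <= K ->
    m1 <= Num.max 0 (m + b - a) ->
  Num.max 0 (Num.min m1 K - x) + (m \in `]x + L, K])%:R * Num.min a L <=
  Num.max 0 (Num.min m K - x) + (Num.max 0 (b - (x - T)) +
    ((m \in `](x - T), K])%:R * b + (m \in `]T, (x - T)])%:R * Num.max 0 (b - (x - m)))).
Proof.
move=> a0 b0 T0 Tx L0 xK hm1.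
have h1 : Num.max 0 (Num.min m1 K - x) <= Num.max 0 (m + b - a - x).
  rewrite ge_max le_max lexx /=.
  have : Num.min m1 K <= m1 by rewrite ge_min lexx.
  move: hm1; rewrite !le_max => /orP[h2 h3|h2 h3]; apply/orP; [left|right]; lra.
have h2 : Num.max 0 (Num.min m1 K - x) <= K - x.
  rewrite ge_max; apply/andP; split; first by lra.
  by rewrite lerD2r ge_min lexx orbT.
rewrite le_max in h1; move/orP: h1 h2.
have u2_ge0 : 0 <= Num.max 0 (b - (x - T)) by rewrite le_max lexx.
have u2_ge : b - (x - T) <= Num.max 0 (b - (x - T)) by rewrite le_max lexx orbT.
have u3_ge : b - (x - m) <= Num.max 0 (b - (x - m)) by rewrite le_max lexx orbT.
have u3_ge0 : 0 <= Num.max 0 (b - (x - m)) by rewrite le_max lexx.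
move: u2_ge0 u2_ge u3_ge u3_ge0.
move: (Num.max 0 (Num.min m1 K - x)) (Num.max 0 (b - (x - T))) => u1 u2.
move: (Num.max 0 (b - (x - m))) => u3 u2_ge0 u2_ge u3_ge u3_ge0 h1 h2.
have c_ge0 : 0 <= Num.max 0 (Num.min m K - x) by rewrite le_max lexx.
have c_ge : Num.min m K - x <= Num.max 0 (Num.min m K - x).
  by rewrite le_max lexx orbT.
have b3 : 0 <= (m \in `](x - T), K])%:R * b by rewrite mulr_ge0.
have b4 : 0 <= (m \in `]T, (x - T)])%:R * u3 by rewrite mulr_ge0.
have [Km|mK] := ltP K m.
  rewrite min_r ?(ltW Km)// in c_ge c_ge0 *.
  by rewrite in_itv /= (leNgt m K) Km andbF mul0r; lra.
rewrite min_l// in c_ge c_ge0 *; rewrite !in_itv /= mK !andbT in b3 b4 *.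
have [xm|mx] := ltP (x - T) m; rewrite ?andbF ?mul1r ?mul0r ?add0r ?addr0 in b3 *.
  have [xLm|mxL] := ltP (x + L) m; rewrite /= ?mul1r ?mul0r.
    have minA : Num.min a L <= a by rewrite ge_min lexx.
    have minL : Num.min a L <= L by rewrite ge_min lexx orbT.
    by case: h1 => h1; lra.
  have [xm'|mx'] := leP x m; by case: h1 => h1; lra.
rewrite ltNge (_ : m <= x + L) ?mul0r/=; last by lra.
have [Tm|mT] := ltP T m; rewrite ?mul1r ?mul0r; by case: h1 => h1; lra.
Qed.

Section UpperStep.
Context {d : measure_display} {Omega : measurableType d} {R : realType}.
Variables (P : probability Omega R) (nu : probability R R).
Variables (M M1 A B : Omega -> R) (al b : R).
Local Notation H := (tail_prob nu).
Local Notation f := (fun x : R => fine (P [set w | x < M w])).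

Hypotheses (mM : measurable_fun setT M) (mM1 : measurable_fun setT M1).
Hypotheses (mA : measurable_fun setT A) (mB : measurable_fun setT B).
Hypotheses (A_ge0 : forall w, 0 <= A w) (B_ge0 : forall w, 0 <= B w).
Hypothesis M1_law : forall y, P [set w | y < M1 w] = P [set w | y < M w].
Hypothesis M1_le : forall w, M1 w <= Num.max 0 (M w + B w - A w).
Hypotheses (MA : indep_rv P M A) (MB : indep_rv P M B).
Hypothesis A_mean : (\int[P]_w (A w)%:E)%E = al%:E.
Hypothesis B_mean : (\int[P]_w (B w)%:E)%E = b%:E.
Hypothesis B_tail : forall x, 0 <= x ->
  (\int[lebesgue_measure]_(y in `]x, +oo[) P [set w | (y < B w)%R] = (b * H x)%:E)%E.

Let b_ge0 : 0 <= b.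
Proof. by rewrite -lee_fin -B_mean; apply: integral_ge0 => w _; rewrite lee_fin. Qed.

Let mexcess x : measurable_fun setT (fun w => Num.max 0 (B w - (x - M w))).
Proof.
by apply: measurable_maxr => //; apply: measurable_funB => //; exact: measurable_funB.
Qed.

Let minA_fin L : 0 <= L -> (\int[P]_w (Num.min (A w) L)%:E)%E \is a fin_num.
Proof.
move=> L0; have minA0 w : 0 <= Num.min (A w) L by rewrite le_min A_ge0.
rewrite ge0_fin_numE; last by apply: integral_ge0 => w _; rewrite lee_fin.
apply: (@le_lt_trans _ _ al%:E); last by rewrite ltry.
rewrite -A_mean; apply: ge0_le_integral => //.
- by move=> w _; rewrite lee_fin.
- by apply/measurable_EFinP; exact: measurable_minr.
- exact/measurable_EFinP.
- by move=> w _; rewrite lee_fin ge_min lexx.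
Qed.

(** A backlog in [`]T, x - T]] exceeds [x] after the arrival only if the new job is
    larger than [T] too. Replacing the tail [f] of the backlog by its bound [l * H]
    turns the mean excess into the tail of two large residual sizes. *)
Let overlap_le T x l : 0 <= T -> 2 * T <= x -> 0 <= l ->
    (forall y, 0 <= y <= x -> f y <= l * H y) ->
  (\int[P]_(w in M @^-1` `]T, (x - T)%R]) (Num.max 0 (B w - (x - M w)))%:E <=
   (b * (l * both_large_tail nu T x))%:E)%E.
Proof.
move=> T0 Tx l0 fl.
have mE : measurable (M @^-1` `]T, x - T]) by exact: measurable_preimage.
rewrite integral_layers//; last exact: measurable_funB.
rewrite (_ : b * _ = l * (b * both_large_tail nu T x)); last by ring.
rewrite EFinM -(both_large_tailE mB b_ge0 B_tail)//.
have mprod : measurable_fun setT (fun y : R =>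
    (H (Num.max T (x - y)))%:E * P [set w | (y < B w)%R])%E.
  apply: emeasurable_funM; last exact: measurable_tail.
  apply/measurable_EFinP; apply: (measurableT_comp (f := H)).
    by apply: nonincreasing_measurable => // u v; exact: tail_prob_nonincr.
  by apply: measurable_maxr => //; exact: measurable_funB.
have mprodT : measurable_fun `]T, +oo[ (fun y : R =>
    (H (Num.max T (x - y)))%:E * P [set w | (y < B w)%R])%E.
  exact: measurable_funTS.
rewrite -ge0_integralZl//; last by move=> y _; rewrite mule_ge0// lee_fin tail_prob_ge0.
rewrite [leRHS]integral_mkcond; apply: ge0_le_integral => //.
- by apply: measurable_layers => //; exact: measurable_funB.
- apply/(measurable_restrictT _ _).1 => //; exact: measurable_funeM.
move=> y _; rewrite patchE; case: ifPn => [|/negP hy]; last first.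
  rewrite (_ : _ `&` _ = set0) ?measure0//; apply/seteqP; split => w //=.
  rewrite !in_itv /= => -[/andP[_ h1] /andP[h2 _]]; apply: hy.
  by rewrite inE /= in_itv /= andbT; lra.
rewrite inE /= in_itv /= andbT => Ty.
have Tx' : T <= x by lra.
apply: (@le_trans _ _ (P (M @^-1` `]Num.max T (x - y), +oo[ `&` B @^-1` `]y, +oo[))).
  apply: le_measure; rewrite ?inE.
  - apply: measurableI => //; apply: measurable_between => //.
    exact: measurable_funB.
  - by apply: measurableI; exact: measurable_preimage.
  move=> w /=; rewrite !in_itv /= !andbT gt_max => -[/andP[-> _] /andP[h ->]].
  by split => //; lra.
rewrite MB// muleA.
have -> : B @^-1` `]y, +oo[ = [set w | y < B w].
  by apply/seteqP; split => w /=; rewrite in_itv /= andbT.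
apply: lee_wpmul2r => //.
have -> : M @^-1` `]Num.max T (x - y), +oo[ = [set w | Num.max T (x - y) < M w].
  by apply/seteqP; split => w /=; rewrite in_itv /= andbT.
rewrite probE; last by exact: measurable_ltr_set.
rewrite -EFinM lee_fin; apply: fl; rewrite le_max T0 ge_max Tx' /=; lra.
Qed.

(* The integral of [lindley_step_le], where the capped means of [M] and [M1] cancel. *)
Let main_le T x l L K : 0 <= T -> 2 * T <= x -> 0 <= l -> 0 <= L -> x + L <= K ->
    (forall y, 0 <= y <= x -> f y <= l * H y) ->
  fine (\int[P]_w (Num.min (A w) L)%:E)%E * (f (x + L) - f K) <=
  b * (H (x - T) + l * both_large_tail nu T x + f (x - T)).
Proof.
move=> T0 Tx l0 L0 xK fl.
pose a1 w := Num.max 0 (Num.min (M1 w) K - x).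
pose c1 w := Num.max 0 (Num.min (M w) K - x).
pose E1 := M @^-1` `]x + L, K]; pose E3 := M @^-1` `]x - T, K].
pose E4 := M @^-1` `]T, x - T].
have mE1 : measurable E1 by exact: measurable_preimage.
have mE3 : measurable E3 by exact: measurable_preimage.
have mE4 : measurable E4 by exact: measurable_preimage.
pose a2 w := \1_E1 w * Num.min (A w) L.
pose c2 w := Num.max 0 (B w - (x - T)).
pose c3 w := \1_E3 w * B w.
pose c4 w := \1_E4 w * Num.max 0 (B w - (x - M w)).
have minA0 w : 0 <= Num.min (A w) L by rewrite le_min A_ge0.
have mminA : measurable_fun setT (fun w => Num.min (A w) L) by exact: measurable_minr.
have ma1 : measurable_fun setT a1.
  by apply: measurable_maxr => //; apply: measurable_funB => //; exact: measurable_minr.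
have mc1 : measurable_fun setT c1.
  by apply: measurable_maxr => //; apply: measurable_funB => //; exact: measurable_minr.
have ma2 : measurable_fun setT a2 by apply: measurable_funM => //; exact: measurable_indic.
have mc2 : measurable_fun setT c2.
  by apply: measurable_maxr => //; exact: measurable_funB.
have mc3 : measurable_fun setT c3 by apply: measurable_funM => //; exact: measurable_indic.
have mc4 : measurable_fun setT c4.
  apply: measurable_funM => //; exact: mexcess.
have max0 (u : R) : 0 <= Num.max 0 u by rewrite le_max lexx.
have ind0 (E : set Omega) w : 0 <= \1_E w :> R by rewrite indicE ler0n.
have mc34 : measurable_fun setT (fun w => c3 w + c4 w) by exact: measurable_funD.
have mc234 : measurable_fun setT (fun w => c2 w + (c3 w + c4 w)) by exact: measurable_funD.
have c34 w : 0 <= c3 w + c4 w by rewrite addr_ge0// mulr_ge0.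
have c234 w : 0 <= c2 w + (c3 w + c4 w) by rewrite addr_ge0// max0.
have : (\int[P]_w (a1 w + a2 w)%:E <=
        \int[P]_w (c1 w + (c2 w + (c3 w + c4 w)))%:E)%E.
  apply: ge0_le_integral => //.
  - by move=> w _; rewrite lee_fin addr_ge0 ?max0// mulr_ge0.
  - by apply/measurable_EFinP; exact: measurable_funD.
  - by apply/measurable_EFinP; exact: measurable_funD.
  move=> w _; rewrite lee_fin /a1 /a2 /c1 /c2 /c3 /c4 !indicE.
  have memE (i : interval R) : (w \in M @^-1` [set` i]) = (M w \in i).
    by apply/idP/idP; rewrite inE.
  by rewrite !memE; apply: lindley_step_le.
have a1_ge0 w : 0 <= a1 w by exact: max0.
have c1_ge0 w : 0 <= c1 w by exact: max0.
have c2_ge0 w : 0 <= c2 w by exact: max0.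
have a2_ge0 w : 0 <= a2 w by rewrite mulr_ge0.
have c3_ge0 w : 0 <= c3 w by rewrite mulr_ge0.
have c4_ge0 w : 0 <= c4 w by rewrite mulr_ge0.
have -> : (\int[P]_w (c1 w + (c2 w + (c3 w + c4 w)))%:E = \int[P]_w (c1 w)%:E +
    (\int[P]_w (c2 w)%:E + (\int[P]_w (c3 w)%:E + \int[P]_w (c4 w)%:E)))%E.
  rewrite -(ge0_integralD_real P mc3 mc4)// -(ge0_integralD_real P mc2 mc34)//.
  by rewrite -(ge0_integralD_real P mc1 mc234).
rewrite (ge0_integralD_real P ma1 ma2)//.
have -> : (\int[P]_w (a1 w)%:E = \int[P]_w (c1 w)%:E)%E.
  by rewrite !integral_capped//; apply: eq_integral => y _; exact: M1_law.
rewrite leeD2lE; last exact: integral_capped_fin.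
rewrite /a2 /c3 /c4 !integral_indic_mul//.
rewrite integral_indep_rv//; last first.
  apply: (indep_rv_comp (h := fun u => Num.min u L)) => //.
  exact: measurable_minr.
rewrite integral_indep_rv// B_mean integral_excess// B_tail; last by lra.
have mf := minA_fin L0.
rewrite -(fineK mf); set mL := fine _.
have mL0 : 0 <= mL by rewrite fine_ge0// integral_ge0// => w _; rewrite lee_fin.
rewrite [P _]probE// [P (M @^-1` `]x - T, K])]probE//.
move=> /le_trans /(_ (leeD2l _ (leeD2l _ (overlap_le T0 Tx l0 fl)))).
rewrite -!EFinM -!EFinD lee_fin => h.
have mS y : measurable [set w | y < M w] by exact: measurable_ltr_set.
have e3 : fine (P E3) <= fine (P [set w | x - T < M w]).
  by apply: (fine_measure_le (prob_lty P)) => // w; rewrite /E3 /= in_itv /= => /andP[].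
have e1 : fine (P [set w | x + L < M w]) - fine (P [set w | K < M w]) <= fine (P E1).
  rewrite lerBlDr -lee_fin EFinD -!probE//; apply: le_trans (measureU2 _ _ _) => //.
  apply: le_measure; rewrite ?inE//; first exact: measurableU.
  move=> w /= xLM; case: (leP (M w) K) => MK; last by right.
  by left; rewrite /E1 /= in_itv /= xLM.
have := ler_wpM2l mL0 e1; have := ler_wpM2l b_ge0 e3.
by rewrite -/E1 -/E3 /= in h *; lra.
Qed.

(** As [M1] has the law of [M], the mean of its capped excess over [x] does not change
    in one step: the drift towards [0] above the level balances the upward
    crossings of the level. The losses on the left come from backlogs above
    [x + L]; the terms on the right come from the new job alone, from both the
    backlog and the job being large, and from backlogs above [x - T]. The cap
    [K] tends to infinity at the end. *)
Lemma upper_step e : 0 < e -> exists2 L, 0 <= L &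
  forall T x l, 0 <= T -> 2 * T <= x -> 0 <= l ->
    (forall y, 0 <= y <= x -> f y <= l * H y) ->
  (al - e) * f (x + L) <= b * (H (x - T) + l * both_large_tail nu T x + f (x - T)).
Proof.
move=> e0.
have [L L0 hL] := min_mean_ge mA A_ge0 A_mean e0.
exists L => // T x l T0 Tx l0 fl.
have f0 y : 0 <= f y by rewrite fine_ge0.
set r := b * _.
pose mL := fine (\int[P]_w (Num.min (A w) L)%:E)%E.
have mLle : al - e <= mL.
  by rewrite -lee_fin (le_trans hL)// fineK// minA_fin.
apply: (@le_trans _ _ (mL * f (x + L))); first by rewrite ler_wpM2r.
have cv : mL * (f (x + L) - f K) @[K --> +oo] --> mL * (f (x + L) - 0).
  by apply: cvgMr; apply: cvgB; [exact: cvg_cst|exact: tail_cvg0].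
rewrite subr0 in cv; apply: (cvgr_to_le cv).
by near=> K; apply: main_le => //; near: K; apply: nbhs_pinfty_ge; rewrite num_real.
Unshelve. all: by end_near.
Qed.

End UpperStep.

(** * A lower inequality for one step *)

(** The excess over [x], capped at [J + J], loses at most [a] in one step. It gains
    [Num.min v J] on [`]x, x + J]], where the cap is out of reach, and what [v] exceeds
    [x + T] by when [u] is below [x] and [a] is at most [T]. *)
Lemma lindley_step_ge {R : realType} (u u1 a v x T J : R) :
    0 <= u -> 0 <= a -> 0 <= v -> 0 <= J -> 0 <= x -> 0 <= T ->
    u + v - a <= u1 ->
  Num.max 0 (Num.min u (x + J + J) - x) +
    ((u \in `]x, x + J])%:R * Num.max 0 (Num.min v J - 0) +
     ((u \in `]-oo, x]) && (a \in `]-oo, T]))%:R *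
       Num.max 0 (Num.min v (x + T + J) - (x + T))) <=
  Num.max 0 (Num.min u1 (x + J + J) - x) + (u \in `]x, +oo[)%:R * a.
Proof.
move=> u0 a0 v0 J0 x0 T0 hu1.
have h1 : Num.min (u + v - a) (x + J + J) <= Num.min u1 (x + J + J).
  by rewrite le_min !ge_min hu1 lexx orbT.
have h2 : Num.min u1 (x + J + J) - x <= Num.max 0 (Num.min u1 (x + J + J) - x).
  by rewrite le_max lexx orbT.
have h3 : 0 <= Num.max 0 (Num.min u1 (x + J + J) - x) by rewrite le_max lexx.
move: h1 h2 h3.
move: (Num.min u1 _) => p; move: (Num.max 0 (p - x)) => q.
rewrite !in_itv /= !andbT.
rewrite ge_min => /orP h1 h2 h3.
have [ux|xu] := leP u x; rewrite /= ?mul0r ?mul1r ?add0r ?addr0.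
  rewrite max_l; last by rewrite subr_le0 ge_min ux.
  rewrite add0r; have [aT|Ta] := leP a T; rewrite /= ?mul0r ?mul1r//.
  have : Num.min v (x + T + J) <= v by rewrite ge_min lexx.
  have : Num.min v (x + T + J) <= x + T + J by rewrite ge_min lexx orbT.
  move: (Num.min v _) => r hr1 hr2; rewrite ge_max h3 /=.
  by case: h1 => h1; lra.
have hu : Num.min u (x + J + J) <= u by rewrite ge_min lexx.
have hK : Num.min u (x + J + J) <= x + J + J by rewrite ge_min lexx orbT.
rewrite (max_r (x := 0)); last by rewrite subr_ge0 le_min ltW//=; lra.
have [uJ|Ju] := leP u (x + J); rewrite /= ?mul0r ?mul1r ?addr0.
  have : Num.min v J <= v by rewrite ge_min lexx.
  have : Num.min v J <= J by rewrite ge_min lexx orbT.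
  rewrite subr0 max_r; last by rewrite le_min v0.
  by move: (Num.min v J) => r hr1 hr2; case: h1 => h1; lra.
by case: h1 => h1; lra.
Qed.

Section LowerStep.
Context {d : measure_display} {Omega : measurableType d} {R : realType}.
Variables (P : probability Omega R) (nu : probability R R).
Variables (U U1 A X : Omega -> R) (al c : R).
Local Notation H := (tail_prob nu).
Local Notation f := (fun x : R => fine (P [set w | x < U w])).

Hypotheses (mU : measurable_fun setT U) (mU1 : measurable_fun setT U1).
Hypotheses (mA : measurable_fun setT A) (mX : measurable_fun setT X).
Hypotheses (U_ge0 : forall w, 0 <= U w) (A_ge0 : forall w, 0 <= A w).
Hypotheses (X_ge0 : forall w, 0 <= X w).
Hypothesis U1_law : forall y, P [set w | y < U1 w] = P [set w | y < U w].
Hypothesis U1_ge : forall w, U w + X w - A w <= U1 w.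
Hypothesis UAX : forall E F G : set R, measurable E -> measurable F -> measurable G ->
  P (U @^-1` E `&` A @^-1` F `&` X @^-1` G) =
  (P (U @^-1` E) * P (A @^-1` F) * P (X @^-1` G))%E.
Hypothesis A_mean : (\int[P]_w (A w)%:E)%E = al%:E.
Hypothesis nu_pos : nu `]0, +oo[%classic = 1%E.
Hypothesis c_ge0 : 0 <= c.
Hypothesis X_tail : forall x y, 0 <= x -> x <= y ->
  ((c * (H x - H y))%:E <=
   \int[lebesgue_measure]_(t in `]x, y[) P [set w | (t < X w)%R])%E.

Let UA : indep_rv P U A.
Proof.
move=> E F mE mF; have := UAX mE mF measurableT.
by rewrite !preimage_setT !setIT probability_setT mule1.
Qed.

Let UX : indep_rv P U X.
Proof.
move=> E F mE mF; have := UAX mE measurableT mF.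
by rewrite !preimage_setT !setIT probability_setT mule1.
Qed.

Let capped (z J : R) w := Num.max 0 (Num.min (X w) (z + J) - z).

Let mcapped z J : measurable_fun setT (capped z J).
Proof.
apply: measurable_maxr => //; apply: measurable_funB => //.
exact: measurable_minr.
Qed.

Let capped_ge z J : 0 <= z -> 0 <= J ->
  c * (H z - H (z + J)) <= fine (\int[P]_w (capped z J w)%:E)%E.
Proof.
move=> z0 J0; rewrite -lee_fin fineK; last exact: integral_capped_fin.
by rewrite /capped integral_capped// X_tail// lerDl.
Qed.

Let finite_step x T J : 0 <= x -> 0 <= T -> 0 <= J ->
  (f x - f (x + J)) * (c * (1 - H J)) +
  (1 - f x) * fine (P [set w | A w <= T]) * (c * (H (x + T) - H (x + T + J))) <=
  al * f x.
Proof.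
move=> x0 T0 J0.
pose K := x + J + J.
pose E1 := U @^-1` `]x, x + J]; pose E3 := U @^-1` `]x, +oo[.
pose E2 := U @^-1` `]-oo, x] `&` A @^-1` `]-oo, T].
have mE1 : measurable E1 by exact: measurable_preimage.
have mE3 : measurable E3 by exact: measurable_preimage.
have mE2 : measurable E2 by apply: measurableI; exact: measurable_preimage.
pose a1 w := Num.max 0 (Num.min (U w) K - x).
pose a2 w := \1_E1 w * Num.max 0 (Num.min (X w) J - 0).
pose a3 w := \1_E2 w * capped (x + T) J w.
pose c1 w := Num.max 0 (Num.min (U1 w) K - x).
pose c2 w := \1_E3 w * A w.
have capE : (fun w => Num.max 0 (Num.min (X w) J - 0)) = capped 0 J.
  by apply/funext => w; rewrite /capped add0r.
have m1 : measurable_fun setT a1.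
  by apply: measurable_maxr => //; apply: measurable_funB => //; exact: measurable_minr.
have m2 : measurable_fun setT a2.
  by apply: measurable_funM => //; rewrite capE.
have m3 : measurable_fun setT a3 by exact: measurable_funM.
have m4 : measurable_fun setT c1.
  by apply: measurable_maxr => //; apply: measurable_funB => //; exact: measurable_minr.
have m5 : measurable_fun setT c2 by exact: measurable_funM.
have max0 (u : R) : 0 <= Num.max 0 u by rewrite le_max lexx.
have ind0 (E : set Omega) w : 0 <= \1_E w :> R by rewrite indicE ler0n.
have a1_ge0 w : 0 <= a1 w by exact: max0.
have a2_ge0 w : 0 <= a2 w by rewrite mulr_ge0.
have a3_ge0 w : 0 <= a3 w by rewrite mulr_ge0// max0.
have c1_ge0 w : 0 <= c1 w by exact: max0.
have c2_ge0 w : 0 <= c2 w by rewrite mulr_ge0.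
have m23 : measurable_fun setT (fun w => a2 w + a3 w) by exact: measurable_funD.
have a23_ge0 w : 0 <= a2 w + a3 w by rewrite addr_ge0.
have : (\int[P]_w (a1 w + (a2 w + a3 w))%:E <= \int[P]_w (c1 w + c2 w)%:E)%E.
  apply: ge0_le_integral => //.
  - by move=> w _; rewrite lee_fin addr_ge0.
  - by apply/measurable_EFinP; exact: measurable_funD.
  - by apply/measurable_EFinP; exact: measurable_funD.
  move=> w _; rewrite lee_fin /a1 /a2 /a3 /c1 /c2 !indicE.
  have memE (Y : Omega -> R) (i : interval R) : (w \in Y @^-1` [set` i]) = (Y w \in i).
    by apply/idP/idP; rewrite inE.
  rewrite /E2 in_setI !memE; exact: lindley_step_ge.
have -> : (\int[P]_w (a1 w + (a2 w + a3 w))%:E = \int[P]_w (a1 w)%:E +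
    (\int[P]_w (a2 w)%:E + \int[P]_w (a3 w)%:E))%E.
  by rewrite -(ge0_integralD_real P m2 m3)// -(ge0_integralD_real P m1 m23).
rewrite (ge0_integralD_real P m4 m5)//.
have -> : (\int[P]_w (c1 w)%:E = \int[P]_w (a1 w)%:E)%E.
  by rewrite !integral_capped//; apply: eq_integral => y _; exact: U1_law.
rewrite leeD2lE; last exact: integral_capped_fin.
rewrite /a2 /a3 /c2 !integral_indic_mul//.
under [X in (X + _ <= _)%E]eq_integral do rewrite -[X in Num.min _ X]add0r -/(capped 0 J _).
rewrite (integral_indep_rv (X := U) (Z := capped 0 J))//; last 2 first.
- by move=> w; exact: max0.
- apply: (indep_rv_comp (h := fun v => Num.max 0 (Num.min v (0 + J) - 0))) => //.
  apply: measurable_maxr => //; apply: measurable_funB => //; exact: measurable_minr.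
rewrite (integral_indep (P := P) mE2 (mcapped (x + T) J))//; last 2 first.
- by move=> w; exact: max0.
- move=> F mF; rewrite /E2 /capped.
  pose h v := Num.max 0 (Num.min v (x + T + J) - (x + T)).
  have mh : measurable_fun setT h.
    by apply: measurable_maxr => //; apply: measurable_funB => //; exact: measurable_minr.
  have mhF : measurable (h @^-1` F) by exact: measurable_preimage.
  by rewrite -[_ @^-1` F]/(X @^-1` (h @^-1` F)) UAX// UA.
rewrite (integral_indep_rv (X := U) (Z := A))// A_mean.
have fin2 z : (\int[P]_w (capped z J w)%:E)%E \is a fin_num.
  exact: integral_capped_fin.
have hz0 := capped_ge (lexx 0) J0; have hz := capped_ge (addr_ge0 x0 T0) J0.
rewrite -(fineK (fin2 0)) -(fineK (fin2 (x + T))).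
rewrite [P E1]probE// [P E2]probE// [P (U @^-1` `]x, +oo[)]probE//.
rewrite -!EFinM -!EFinD lee_fin.
have e3 : U @^-1` `]x, +oo[ = [set w | x < U w].
  by apply/seteqP; split => w /=; rewrite in_itv /= andbT.
have mS y : measurable [set w | y < U w] by exact: measurable_ltr_set.
have e1 : fine (P [set w | x < U w]) - fine (P [set w | x + J < U w]) <= fine (P E1).
  rewrite lerBlDr -lee_fin EFinD -!probE//; apply: le_trans (measureU2 _ _ _) => //.
  apply: le_measure; rewrite ?inE//; first exact: measurableU.
  move=> w /= xU; case: (leP (U w) (x + J)) => UJ; last by right.
  by left; rewrite /E1 /= in_itv /= xU.
have e2 : fine (P E2) = (1 - fine (P [set w | x < U w])) * fine (P [set w | A w <= T]).
  rewrite /E2 UA// fineM ?(measure_fin_num (prob_lty P))//; try exact: measurable_preimage.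
  congr (_ * _).
  rewrite (_ : _ @^-1` _ = ~` [set w | x < U w]).
    by rewrite probability_setC// fineB// ?(measure_fin_num (prob_lty P)).
  by apply/seteqP; split => w /=; rewrite in_itv /= leNgt => /negP.
rewrite e3 e2 {1}(tail_prob0 nu_pos) in hz0 *.
have p1 : 0 <= fine (P E1) by rewrite fine_ge0.
have p2 : 0 <= fine (P E2) by rewrite fine_ge0.
rewrite -e2 add0r in hz0 *.
have c1H : 0 <= c * (1 - H J) by rewrite mulr_ge0// subr_ge0 tail_prob_le1.
have := ler_wpM2l p2 hz; have := ler_wpM2l p1 hz0; have := ler_wpM2r c1H e1.
move: (fine (P E1)) (fine (P E2)) => P1 P2.
move=> g1 g2 g3 g4.
apply: le_trans (_ : P1 * (c * (1 - H J)) + P2 * (c * (H (x + T) - H (x + T + J))) <= _).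
  by rewrite lerD2r.
by apply: le_trans (lerD g2 g3) _; rewrite [leRHS]mulrC.
Qed.

(** The mean of the capped excess over [x] does not change in one step. Above the
    level it decreases by at most [al - c] on average, and this has to make up for
    the single jumps that cross the level from below. *)
Lemma lower_step x T : 0 <= x -> 0 <= T ->
  (1 - f x) * fine (P [set w | A w <= T]) * (c * H (x + T)) <= (al - c) * f x.
Proof.
move=> x0 T0.
pose F := fine (P [set w | x < U w]).
pose p := fine (P [set w | A w <= T]).
have fJ : fine (P [set w | x + J < U w]) @[J --> +oo] --> (0 : R).
  apply: squeeze_cvgr (cvg_cst 0) (tail_cvg0 P mU).
  near=> J; rewrite fine_ge0//=; apply: (fine_measure_le (prob_lty P)).
  - exact: measurable_ltr_set.
  - exact: measurable_ltr_set.
  - by move=> w /=; lra.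
have HJ := @tail_prob_cvg0 _ nu.
have HJ' : H (x + T + J) @[J --> +oo] --> (0 : R).
  apply: squeeze_cvgr (cvg_cst 0) HJ.
  by near=> J; rewrite tail_prob_ge0/= tail_prob_nonincr//; lra.
have cv : (F - fine (P [set w | x + J < U w])) * (c * (1 - H J)) +
    (1 - F) * p * (c * (H (x + T) - H (x + T + J))) @[J --> +oo] -->
  (F - 0) * (c * (1 - 0)) + (1 - F) * p * (c * (H (x + T) - 0)).
  apply: cvgD; [apply: cvgM|apply: cvgMr].
  - by apply: cvgB => //; exact: cvg_cst.
  - by apply: cvgMr; apply: cvgB => //; exact: cvg_cst.
  - by apply: cvgMr; apply: cvgB => //; exact: cvg_cst.
rewrite !subr0 mulr1 in cv.
suff : F * c + (1 - F) * p * (c * H (x + T)) <= al * F by rewrite -/F -/p; lra.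
apply: (cvgr_to_le cv); near=> J.
by apply: finite_step => //; near: J; apply: nbhs_pinfty_ge; rewrite num_real.
Unshelve. all: by end_near.
Qed.

End LowerStep.

(** * Order statistics and the assignment of a job *)

Local Close Scope classical_set_scope.

Section OrderStatistics.
Context {R : realType}.
Implicit Types (s : seq R) (z : R).

Lemma order_stat_ge j s z : (0 < j <= size s)%N ->
  (z <= order_stat j s) = (count (fun x => (x < z)%R) s < j)%N.
Proof.
move=> /andP[j0 js]; rewrite /order_stat.
have ss : sorted <=%O (sort <=%O s) by apply: sort_sorted; exact: le_total.
have jE : (j.-1 < j)%N by rewrite prednK.
have cE : count (< z)%O (sort <=%O s) = count (fun x => (x < z)%R) s.
  by apply/seq.permP; rewrite perm_sort.
case: ltnP => h.
  apply: nth_count_ge => //; rewrite cE size_sort prednK// js andbT.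
  by rewrite -ltnS prednK.
apply/negbTE; rewrite -ltNge; apply: nth_count_lt => //.
by rewrite cE (leq_trans _ h)// prednK.
Qed.

Lemma order_stat_gt j s z : (0 < j <= size s)%N ->
  (z < order_stat j s) = (count (fun x => (x <= z)%R) s < j)%N.
Proof.
move=> /andP[j0 js]; rewrite /order_stat.
have ss : sorted <=%O (sort <=%O s) by apply: sort_sorted; exact: le_total.
have cE : count (<= z)%O (sort <=%O s) = count (fun x => (x <= z)%R) s.
  by apply/seq.permP; rewrite perm_sort.
case: ltnP => h.
  apply: nth_count_gt => //; rewrite cE size_sort prednK// js andbT.
  by rewrite -ltnS prednK.
apply/negbTE; rewrite -leNgt; apply: nth_count_le => //.
by rewrite cE (leq_trans _ h)// prednK.
Qed.

Context {n : nat}.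
Implicit Types (t : n.-tuple R) (I : {set 'I_n}).

Lemma count_tuple (p : pred R) t : count p t = #|[set i | p (tnth t i)]|.
Proof.
rewrite -{1}(map_tnth_enum t) count_map -sum1_count -sum1dep_card.
by rewrite big_enum_cond.
Qed.

Lemma order_stat_ge_set j t I z : (0 < j <= n)%N -> (n - j < #|I|)%N ->
  (forall i, i \in I -> z <= tnth t i) -> z <= order_stat j t.
Proof.
move=> /andP[j0 jn] nI zI; rewrite order_stat_ge ?size_tuple ?j0// count_tuple.
have sub : [set i | tnth t i < z] \subset ~: I.
  by apply/fintype.subsetP => i; rewrite !inE; apply: contraTN => /zI; rewrite leNgt.
have := subset_leq_card sub; have := cardsC I; rewrite card_ord; move: j0 jn nI.
move: #|I| #|~: I| #|[set i | (tnth t i < z)%R]| => a b c; lia.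
Qed.

Lemma order_stat_le_set j t I z : (0 < j <= n)%N -> (j <= #|I|)%N ->
  (forall i, i \in I -> tnth t i <= z) -> order_stat j t <= z.
Proof.
move=> /andP[j0 jn] jI Iz; rewrite leNgt order_stat_gt ?size_tuple ?j0// count_tuple -leqNgt.
apply: (leq_trans jI); apply: subset_leq_card.
by apply/fintype.subsetP => i /Iz; rewrite inE.
Qed.

Lemma card_le_order_stat j t : (0 < j <= n)%N ->
  (j <= #|[set i | (tnth t i <= order_stat j t)%R]|)%N.
Proof.
move=> jn; rewrite -(count_tuple (fun x => x <= order_stat j t)) leqNgt.
rewrite -order_stat_gt ?size_tuple//.
by rewrite ltxx.
Qed.

Lemma order_stat_perm j t : (0 < j)%N -> exists p : {perm 'I_n},
  forall i : 'I_n, (j.-1 <= i)%N -> order_stat j t <= tnth t (p i).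
Proof.
move=> j0.
have /tuple_permP[p hp] : perm_eq (sort <=%O t) t by rewrite perm_sort.
exists p => i ji.
have -> : tnth t (p i) = nth 0 (sort <=%O t) i by rewrite hp -tnth_nth tnth_mktuple.
apply: (sorted_leq_nth (leT := <=%O)) => //.
- exact: le_trans.
- by apply: sort_sorted; exact: le_total.
- by rewrite inE size_sort size_tuple (leq_ltn_trans ji).
- by rewrite inE size_sort size_tuple.
Qed.

End OrderStatistics.

Section JobAssignment.
Context {R : realType} {N nF : nat} (nJ : nat).
Hypothesis nJ_itv : (0 < nJ <= nF)%N.
Implicit Types (v : N.-tuple R) (s : {ffun 'I_nF -> 'I_N}) (b : nF.-tuple R).

Lemma assign_job_ge v s b k : (forall i, 0 <= tnth b i) ->
  tnth v k <= tnth (assign_job nJ v s b) k.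
Proof.
move=> b0; rewrite tnth_mktuple; case: pickP => // i _.
case: ifP => // /negbT; rewrite -ltNge => /ltW ck.
by rewrite le_min ck lerDl b0.
Qed.

Lemma assign_job_le v s b k :
  tnth (assign_job nJ v s b) k <= Num.max (tnth v k) (completion_time nJ v s b).
Proof.
rewrite tnth_mktuple le_max; case: pickP => [i _|_]; last by rewrite lexx.
by case: ifP => _; rewrite ?ge_min lexx ?orbT.
Qed.

(** The [nJ] smallest replicas are finished by then, even if each of them has to wait
    for the largest backlog. *)
Lemma completion_time_le v s b z : (forall k, tnth v k <= z) ->
  completion_time nJ v s b <= z + order_stat nJ b.
Proof.
move=> vz; apply: (order_stat_le_set nJ_itv (card_le_order_stat b nJ_itv)) => i.
by rewrite inE tnth_mktuple tnth_mktuple; apply: lerD.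
Qed.

Lemma wait_stat_le v s z : (forall k, tnth v k <= z) ->
  order_stat nJ (waiting_times v s) <= z.
Proof.
move=> vz; apply: (order_stat_le_set nJ_itv (I := [set: 'I_nF])) => [|i _].
  by rewrite cardsT card_ord; case/andP: nJ_itv.
by rewrite tnth_mktuple.
Qed.

(** A job placed like this raises the smallest backlog on [T] by at least
    [order_stat nJ b] when [T] has [nF - nJ + 1] servers; see [covers_assign_job]. *)
Definition covers (T : {set 'I_N}) (b : nF.-tuple R) (s : {ffun 'I_nF -> 'I_N}) :=
  [forall (k | k \in T), exists i, (s i == k) && (order_stat nJ b <= tnth b i)].

(** Fewer than [nJ] replicas are outside [T], so the job completes only after one on
    [T] does, and those need [u + order_stat nJ b] at least. None of the servers
    of [T] is released earlier, neither by a completion nor by an abandonment. *)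
Lemma covers_assign_job (T : {set 'I_N}) v s b u k : injective s ->
    (nF - nJ < #|T|)%N -> covers T b s ->
    (forall k, k \in T -> u <= tnth v k) -> k \in T ->
  u + order_stat nJ b <= tnth (assign_job nJ v s b) k.
Proof.
move=> s_inj cT /forall_inP cov uT kT.
have big i : s i \in T -> order_stat nJ b <= tnth b i.
  by move=> /cov /existsP[i' /andP[/eqP /s_inj ->]].
have c_ge : u + order_stat nJ b <= completion_time nJ v s b.
  apply: (order_stat_ge_set nJ_itv (I := [set i | s i \in T])) => [|i].
    apply: (leq_trans cT); rewrite -(card_imset _ s_inj).
    apply/subset_leq_card/fintype.subsetP => k' k'T.
    have /existsP[i /andP[/eqP sik _]] := cov _ k'T.
    by apply/imsetP; exists i; rewrite ?inE sik.
  by rewrite inE tnth_mktuple tnth_mktuple => siT; rewrite lerD ?uT ?big.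
rewrite tnth_mktuple; case: pickP => [i /eqP sik|none]; last first.
  by have /existsP[i /andP[]] := cov _ kT; rewrite none.
case: ifP => h; first exact: le_trans h.
by rewrite le_min c_ge andbT lerD ?uT// big// sik.
Qed.

Lemma wait_stat_ge (J : {set 'I_nF}) v s u : (nF - nJ < #|J|)%N ->
  (forall i, i \in J -> u <= tnth v (s i)) -> u <= order_stat nJ (waiting_times v s).
Proof.
by move=> cJ uJ; apply: (order_stat_ge_set nJ_itv cJ) => i /uJ; rewrite tnth_mktuple.
Qed.

(** The places of the [nF - nJ + 1] largest entries in a sorted tuple. *)
Definition top_indices : {set 'I_nF} := [set i : 'I_nF | (nJ.-1 <= i)%N].

Lemma card_top_indices : #|top_indices| = (nF - nJ + 1)%N.
Proof.
have -> : top_indices = ~: [set i : 'I_nF | (i < nJ.-1)%N].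
  by apply/setP => i; rewrite !inE -leqNgt.
have le : (nJ.-1 <= nF)%N by case/andP: nJ_itv => _; apply: leq_trans; exact: leq_pred.
have -> : [set i : 'I_nF | (i < nJ.-1)%N] = [set widen_ord le i | i in 'I_(nJ.-1)].
  apply/setP => i; rewrite inE; apply/idP/imsetP => [h|[j _ ->]]; last by rewrite /= ltn_ord.
  by exists (Ordinal h) => //; apply: val_inj.
have inj : injective (widen_ord le) by move=> i j /(congr1 val) /= /val_inj.
have := cardsC [set widen_ord le i | i in 'I_(nJ.-1)].
rewrite card_imset// !card_ord; move: nJ_itv.
by move: #|~: _| => a /andP[]; lia.
Qed.

(** A permutation that sorts the sizes sends the largest replicas to
    [s0 @: top_indices]; they may be permuted among these servers at will. *)
Lemma card_covers (s0 : {ffun 'I_nF -> 'I_N}) b :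
    injective s0 ->
  ((#|top_indices|)`! <=
   #|[set s : {ffun 'I_nF -> 'I_N} | injectiveb s && covers (s0 @: top_indices) b s]|)%N.
Proof.
move=> s0_inj.
have [p hp] := order_stat_perm b (proj1 (andP nJ_itv)).
pose F (q : {perm 'I_nF}) : {ffun 'I_nF -> 'I_N} := [ffun i => s0 (q (p^-1%g i))].
have F_inj : injective F.
  move=> q q' /ffunP qq'; apply/perm.permP => i; apply: s0_inj.
  by have := qq' (p i); rewrite !ffunE permK.
rewrite -card_perm -(card_imset _ F_inj); apply/subset_leq_card/fintype.subsetP.
move=> _ /imsetP[q qJ ->]; rewrite inE; apply/andP; split.
  by apply/injectiveP => i i'; rewrite !ffunE => /s0_inj/perm_inj/perm_inj.
apply/forall_inP => _ /imsetP[j jJ ->]; apply/existsP.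
exists (p (q^-1%g j)); rewrite ffunE permK permKV eqxx /=.
by apply: hp; have := perm_closed (q^-1%g j) qJ; rewrite permKV jJ inE => <-.
Qed.

End JobAssignment.

Local Open Scope classical_set_scope.

(** * Measurability of the dynamics *)

Section MeasurableDynamics.
Context {d : measure_display} {T : measurableType d} {R : realType}.

Lemma measurable_gt_sets (f : T -> R) :
  (forall x, measurable [set w | x < f w]) -> measurable_fun setT f.
Proof.
move=> mf mD; apply: (measurability _ (RGenOInfty.measurableE R)) => //.
move=> _ [_ [x ->] <-]; rewrite setTI.
rewrite (_ : _ @^-1` _ = [set w | x < f w]) //.
by apply/seteqP; split => w /=; rewrite in_itv /= andbT.
Qed.

(** An order statistic exceeds [x] when few entries are at most [x], and the number
    of these entries is a sum of indicators. *)
Lemma measurable_order_stat n j (t : T -> n.-tuple R) : (0 < j <= n)%N ->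
  measurable_fun setT t -> measurable_fun setT (fun w => order_stat j (t w)).
Proof.
move=> jn mt; apply: measurable_gt_sets => x.
have mti i : measurable_fun setT (fun w => tnth (t w) i).
  by move/measurable_fun_tnthP : mt => /(_ i).
have key w : (x < order_stat j (t w)) =
    (\sum_(i < n) \1_[set w' | tnth (t w') i <= x] w < j%:R :> R).
  rewrite order_stat_gt ?size_tuple// count_tuple -(ltr_nat R) -sum1dep_card.
  rewrite natr_sum [in LHS]big_mkcond /=; congr (_ < _); apply: eq_bigr => i _.
  rewrite indicE; case: ifPn => h; first by rewrite mem_set.
  by rewrite memNset//=; exact/negP.
under eq_set do rewrite key.
apply: measurable_ltr_set => //; apply: measurable_sum => i.
by apply: measurable_indic; exact: measurable_ler_set.
Qed.

Lemma measurable_select (I : finType) (s : T -> I) (h : I -> T -> R) :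
  (forall i, measurable (s @^-1` [set i])) -> (forall i, measurable_fun setT (h i)) ->
  measurable_fun setT (fun w => h (s w) w).
Proof.
move=> ms mh.
rewrite (_ : (fun w => _) = fun w => \sum_i \1_(s @^-1` [set i]) w * h i w).
  by apply: measurable_sum => i; apply: measurable_funM => //; exact: measurable_indic.
apply/funext => w; rewrite (bigD1 (s w)) //= indicE mem_set// mul1r big1 ?addr0// => i isw.
by rewrite indicE memNset ?mul0r//= => /esym/eqP; apply/negP.
Qed.

Context {N nF : nat} (nJ : nat).
Hypothesis nJ_itv : (0 < nJ <= nF)%N.
Variables (a : T -> R) (v : T -> N.-tuple R) (b : T -> nF.-tuple R).
Variable s : T -> {ffun 'I_nF -> 'I_N}.
Hypotheses (ma : measurable_fun setT a) (mv : measurable_fun setT v).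
Hypothesis mb : measurable_fun setT b.
Hypothesis ms : forall s0, measurable (s @^-1` [set s0]).

Let mvk k : measurable_fun setT (fun w => tnth (v w) k).
Proof. by move/measurable_fun_tnthP : mv => /(_ k). Qed.

Let mbi i : measurable_fun setT (fun w => tnth (b w) i).
Proof. by move/measurable_fun_tnthP : mb => /(_ i). Qed.

Lemma measurable_waiting_times (s0 : {ffun 'I_nF -> 'I_N}) :
  measurable_fun setT (fun w => waiting_times (v w) s0).
Proof.
apply/measurable_fun_tnthP => i.
rewrite (_ : _ \o _ = fun w => tnth (v w) (s0 i))//.
by apply/funext => w /=; rewrite tnth_mktuple.
Qed.

Let mcompletion s0 : measurable_fun setT (fun w => completion_time nJ (v w) s0 (b w)).
Proof.
apply: measurable_order_stat => //; apply/measurable_fun_tnthP => i.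
rewrite (_ : _ \o _ = fun w => tnth (v w) (s0 i) + tnth (b w) i).
  exact: measurable_funD.
by apply/funext => w /=; rewrite !tnth_mktuple.
Qed.

Lemma measurable_elapse_assign_job :
  measurable_fun setT (fun w => elapse (a w) (assign_job nJ (v w) (s w) (b w))).
Proof.
apply/measurable_fun_tnthP => k.
rewrite (_ : _ \o _ =
    fun w => Num.max 0 (tnth (assign_job nJ (v w) (s w) (b w)) k - a w)); last first.
  by apply/funext => w /=; rewrite tnth_mktuple.
apply: measurable_maxr => //; apply: measurable_funB => //.
apply: (measurable_select (h := fun s0 w => tnth (assign_job nJ (v w) s0 (b w)) k)) => // s0.
rewrite (_ : (fun w => _) = fun w => if [pick i | s0 i == k] is Some i then
    if completion_time nJ (v w) s0 (b w) <= tnth (v w) k then tnth (v w) k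
    else Num.min (tnth (v w) k + tnth (b w) i) (completion_time nJ (v w) s0 (b w))
    else tnth (v w) k); last first.
  by apply/funext => w; rewrite tnth_mktuple.
case: pickP => [i _|_] //; apply: measurable_fun_ifT => //.
- exact: measurable_fun_ler.
- by apply: measurable_minr => //; exact: measurable_funD.
Qed.

End MeasurableDynamics.

(** * Independence of the past and the present inputs *)

(** An enumeration of the inputs in which those of job [n] come at the places
    [3 * n + 1], [3 * n + 2] and [3 * n + 3], after the initial state; thus the past
    of a job is an initial segment. *)
Definition nth_input (m : nat) : input :=
  if m is p.+1 then
    match (p %% 3)%N with
    | 0%N => Interarrival (p %/ 3) | 1%N => Sizes (p %/ 3) | _ => Servers (p %/ 3)
    end
  else Initial.

Lemma nth_input_inj : injective nth_input.
Proof.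
pose rank i := match i with
  | Initial => 0%N | Interarrival p => (p * 3).+1
  | Sizes p => (p * 3 + 1).+1 | Servers p => (p * 3 + 2).+1 end.
apply: (can_inj (g := rank)) => -[//|p] /=.
have := ltn_pmod p (isT : 0 < 3)%N; rewrite [in RHS](divn_eq p 3).
by case: (p %% 3)%N => [|[|[|]]] //= _; rewrite addn0.
Qed.

Lemma nth_inputE n :
  [/\ nth_input (3 * n).+1 = Interarrival n, nth_input (3 * n).+2 = Sizes n &
      nth_input (3 * n).+3 = Servers n].
Proof.
have E r : (r < 3)%N -> ((3 * n + r) %% 3 = r)%N /\ ((3 * n + r) %/ 3 = n)%N.
  by move=> r3; rewrite mulnC modnMDl divnMDl// modn_small// divn_small// addn0.
have [[m0 d0] [m1 d1] [m2 d2]] := And3 (E 0%N isT) (E 1%N isT) (E 2%N isT).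
rewrite addn0 in m0 d0; rewrite addn1 in m1 d1; rewrite addn2 in m2 d2.
by split; rewrite /nth_input ?m0 ?m1 ?m2 ?d0 ?d1 ?d2.
Qed.

Section PastInputs.
Context {d : measure_display} {Omega : measurableType d} {R : realType}.
Variable P : probability Omega R.
Context {N nF : nat}.
Variables (A : nat -> {RV P >-> R}) (B : nat -> {RV P >-> nF.-tuple R}).
Variable S : nat -> Omega -> {ffun 'I_nF -> 'I_N}.
Variable V : nat -> {RV P >-> N.-tuple R}.
Local Notation events := (input_events A B S V).
Hypothesis S_meas : forall n s, measurable (S n @^-1` [set s]).
Hypothesis indep : mutually_independent P events.

Lemma input_events_setT i : events i setT.
Proof. by case: i => [|n|n|n] /=; exists setT; rewrite ?setTI ?preimage_setT. Qed.

Lemma input_eventsI i : setI_closed (events i).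
Proof.
by case: i => [|n|n|n] X Y [E mE <-] [F mF <-] /=; exists (E `&` F); rewrite ?preimage_setI//;
  do ?[exact: measurableI]; rewrite setIACA setIid.
Qed.

Lemma measurable_servers n (E : set {ffun 'I_nF -> 'I_N}) : measurable (S n @^-1` E).
Proof.
rewrite (_ : _ @^-1` _ = \bigcup_(s in E) S n @^-1` [set s]).
  by apply: fin_bigcup_measurable => // s _; exact: S_meas.
by apply/seteqP; split => w /=; [move=> h; exists (S n w)|case=> s Es /= ->].
Qed.

Lemma input_events_measurable i : events i `<=` measurable.
Proof.
case: i => [|n|n|n] X [E mE <-] /=; rewrite ?setTI; do ?exact: measurable_servers.
all: exact: measurable_funPTI.
Qed.

(** The product events of the first [k] inputs: a pi-system that generates their
    sigma-algebra and on which the product rule is immediate. *)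
Definition past (k : nat) : set (set Omega) :=
  [set X | exists2 E : nat -> set Omega,
     forall i, (i < k)%N -> events (nth_input i) (E i) & X = \bigcap_(i in `I_k) E i].

Lemma past_setI k : setI_closed (past k).
Proof.
move=> X Y [E hE ->] [F hF ->]; exists (fun i => E i `&` F i).
  by move=> i ik; apply: input_eventsI; [exact: hE|exact: hF].
by rewrite bigcapI.
Qed.

Lemma past_event k i F : (i < k)%N -> events (nth_input i) F -> past k F.
Proof.
move=> ik hF; exists (fun i' => if i' == i then F else setT).
  by move=> i' _; case: eqP => [->//|_]; exact: input_events_setT.
apply/seteqP; split => w /=; first by move=> Fw i' _; case: ifP.
by move=> /(_ i ik); rewrite eqxx.
Qed.

Lemma past_mono k k' : (k <= k')%N -> past k `<=` past k'.
Proof.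
move=> kk' X [E hE ->]; exists (fun i => if (i < k)%N then E i else setT).
  by move=> i _; case: ifP => [/hE//|_]; exact: input_events_setT.
apply/seteqP; split => w /= h i.
  by move=> _; case: ifP => // ik; exact: h.
by move=> ik; have := h i (leq_trans ik kk'); rewrite ik.
Qed.

Lemma past_measurable k : past k `<=` measurable.
Proof.
move=> X [E hE ->]; apply: bigcap_measurableType => i ik.
exact: (input_events_measurable (hE i ik)).
Qed.

Lemma past_indep k m X F : past k X -> (k <= m)%N -> events (nth_input m) F ->
  P (X `&` F) = (P X * P F)%E.
Proof.
move=> [E hE ->] km hF.
have inj1 : injective (fun i : 'I_k => nth_input i).
  by move=> i i' /nth_input_inj/val_inj.
have h1 := indep inj1 (E := fun i : 'I_k => E i) (fun i => hE i (ltn_ord i)).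
pose idx (i : 'I_k.+1) := if (i < k)%N then i : nat else m.
have idx_inj : injective (nth_input \o idx).
  move=> i i' /nth_input_inj; rewrite /idx => h; apply: val_inj; move: h => /=.
  have := ltn_ord i; have := ltn_ord i'.
  by case: (ltnP i k); case: (ltnP i' k); lia.
pose E' (i : 'I_k.+1) := if (i < k)%N then E i else F.
have hE' i : events ((nth_input \o idx) i) (E' i).
  by rewrite /= /E' /idx; case: ifP => // ik; exact: hE.
have := indep idx_inj hE'.
have lastE : E' ord_max = F by rewrite /E' /= ltnn.
rewrite big_ord_recr /= lastE.
rewrite (eq_bigr (fun i : 'I_k => P (E i))); last by move=> i _; rewrite /E' /= ltn_ord.
rewrite -h1 => h2.
have -> : \bigcap_(i in `I_k) E i = \bigcap_(i : 'I_k) E i.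
  apply/seteqP; split => w /= h i; first by move=> _; exact: h (ltn_ord i).
  by move=> ik; exact: (h (Ordinal ik)).
rewrite -h2; congr (P _); apply/seteqP; split => w /=.
  move=> [hw Fw] i _; rewrite /E'; case: ifP => // ik.
  exact: (hw (Ordinal ik)).
move=> h; split; last by have := h ord_max I; rewrite /E' /= ltnn.
move=> i _; have := h (widen_ord (leqnSn k) i) I.
by rewrite /E' /= ltn_ord.
Qed.

(** Two finite measures that agree on a pi-system agree on the sigma-algebra that it
    generates. *)
Lemma sigma_past_indep k m X F : <<s past k >> X -> (k <= m)%N ->
  events (nth_input m) F -> P (X `&` F) = (P X * P F)%E.
Proof.
move=> sX km hF.
have mF := input_events_measurable hF.
have PF : P F = (fine (P F))%:E by exact: probE.
pose p : {nonneg R} := NngNum (fine_ge0 (measure_ge0 P F)).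
have -> : (P X * P F = mscale p P X)%E by rewrite /mscale /= muleC -PF.
rewrite -[LHS]/(mrestr P mF X).
apply: (@g_sigma_algebra_measure_unique _ _ _ (past k) (@past_measurable k)
  (fun=> setT)) X sX.
- by move=> _; exists (fun=> setT); [move=> i _; exact: input_events_setT|rewrite bigcapT].
- by apply/seteqP; split => // w _; exists 0%N.
- exact: past_setI.
- by move=> Y pY; rewrite -[LHS]/(P (Y `&` F)) (past_indep pY km hF) muleC PF.
- by move=> _; rewrite -[X in (X < _)%E]/(P (setT `&` F)) setTI PF ltry.
Qed.

Variable nJ : nat.
Hypothesis nJ_itv : (0 < nJ <= nF)%N.
Hypothesis V_rec : forall n w,
  V n.+1 w = elapse (A n w) (assign_job nJ (V n w) (S n w) (B n w)).

Let Past k := g_sigma_algebraType (past k).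

(** The recursion expresses these backlogs through the inputs of the earlier jobs. *)
Lemma backlogs_past n : measurable_fun (T := Past (3 * n).+1) setT (V n).
Proof.
have past_sub k k' : (k <= k')%N -> <<s past k>> `<=` <<s past k'>>.
  by move=> kk'; apply: sub_sigma_algebra2; exact: past_mono.
elim: n => [|n IH].
  move=> _ E mE; rewrite setTI; apply: sub_sigma_algebra.
  by apply: (@past_event _ 0%N) => //=; exists E => //; rewrite setTI.
have le3 : (3 * n <= 3 * n.+1)%N by rewrite leq_mul2l leqnSn orbT.
have [eA eB eS] := nth_inputE n.
have mV : measurable_fun (T := Past (3 * n.+1).+1) setT (V n).
  by move=> mT E mE; apply: (past_sub (3 * n).+1) => //; exact: IH.
have mA : measurable_fun (T := Past (3 * n.+1).+1) setT (A n).
  move=> _ E mE; rewrite setTI; apply: sub_sigma_algebra.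
  apply: (@past_event _ (3 * n).+1); first by rewrite mulnS; lia.
  by rewrite eA; exists E; rewrite ?setTI.
have mB : measurable_fun (T := Past (3 * n.+1).+1) setT (B n).
  move=> _ E mE; rewrite setTI; apply: sub_sigma_algebra.
  apply: (@past_event _ (3 * n).+2); first by rewrite mulnS; lia.
  by rewrite eB; exists E; rewrite ?setTI.
have mS s : measurable (S n @^-1` [set s] : set (Past (3 * n.+1).+1)).
  apply: sub_sigma_algebra.
  apply: (@past_event _ (3 * n).+3); first by rewrite mulnS; lia.
  by rewrite eS; exists [set s].
have := measurable_elapse_assign_job nJ_itv mA mV mB mS.
by rewrite (_ : (fun w => _) = V n.+1)//; apply/funext => w; rewrite V_rec.
Qed.

Lemma backlogs_indep_servers n (E : set (N.-tuple R)) s : measurable E ->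
  P (V n @^-1` E `&` S n @^-1` [set s]) = (P (V n @^-1` E) * P (S n @^-1` [set s]))%E.
Proof.
move=> mE; have [_ _ eS] := nth_inputE n.
have eventS : events (nth_input (3 * n).+3) (S n @^-1` [set s]).
  by rewrite eS; exists [set s].
apply: (sigma_past_indep (k := (3 * n).+1) _ _ eventS); last by lia.
by have := @backlogs_past n measurableT E mE; rewrite setTI.
Qed.

End PastInputs.

Section Counting.
Context {d : measure_display} {Omega : measurableType d} {R : realType}.
Variables (P : probability Omega R) (I : finType).

Lemma sum_measure_indic (G : I -> set Omega) : (forall i, measurable (G i)) ->
  (\sum_i P (G i) = \int[P]_w (\sum_i \1_(G i) w)%:E)%E.
Proof.
move=> mG; under [RHS]eq_integral do rewrite -sumEFin.
rewrite ge0_integral_sum//; last first.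
  by move=> i; apply/measurable_EFinP; exact: measurable_indic.
by apply: eq_bigr => i _; rewrite integral_indic// setIT.
Qed.

(** Double counting: both sides integrate the number of sets [G i] that contain an
    outcome. *)
Lemma sum_measure_ge (G : I -> set Omega) (E : set Omega) (n : nat) :
    (forall i, measurable (G i)) -> measurable E ->
    (forall w, E w -> (n%:R : R) <= \sum_i \1_(G i) w) ->
  (n%:R%:E * P E <= \sum_i P (G i))%E.
Proof.
move=> mG mE nE; rewrite sum_measure_indic// -(setIT E) -integral_indic// -ge0_integralZl//.
- apply: ge0_le_integral => //.
  + apply: measurable_funeM; apply/measurable_EFinP; exact: measurable_indic.
  + by apply/measurable_EFinP; apply: measurable_sum => i; exact: measurable_indic.
  + move=> w _; rewrite -EFinM lee_fin [X in _ * X]indicE; case: (boolP (w \in E)).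
      by move=> /set_mem /nE; rewrite mulr1.
    by rewrite mulr0 => _; apply: sumr_ge0 => i _; rewrite indicE ler0n.
- by apply/measurable_EFinP; exact: measurable_indic.
Qed.

Lemma law_total (S : Omega -> I) (E : set Omega) :
    (forall i, measurable (S @^-1` [set i])) -> measurable E ->
  (P E = \sum_i P (E `&` S @^-1` [set i]))%E.
Proof.
move=> mS mE; rewrite sum_measure_indic; last by move=> i; exact: measurableI.
rewrite -(setIT E) -integral_indic//; apply: eq_integral => w _; congr (_%:E).
rewrite (bigD1 (S w))//= big1; last first.
  move=> i iS; rewrite indicE memNset//= => -[_ /esym/eqP]; exact/negP.
by rewrite addr0 setIT !indicE in_setI (mem_set (_ : (_ @^-1` _) w))// andbT.
Qed.

End Counting.

Section Inputs.
Context {d : measure_display} {Omega : measurableType d} {R : realType}.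
Variable P : probability Omega R.
Context {N nF : nat}.
Variables (A : nat -> {RV P >-> R}) (B : nat -> {RV P >-> nF.-tuple R}).
Variable S : nat -> Omega -> {ffun 'I_nF -> 'I_N}.
Variable V : nat -> {RV P >-> N.-tuple R}.
Hypothesis indep : mutually_independent P (input_events A B S V).

Lemma indep_first_job (E : set (N.-tuple R)) (F : set R) (G : set (nF.-tuple R)) s :
    measurable E -> measurable F -> measurable G ->
  P (V 0%N @^-1` E `&` A 0%N @^-1` F `&` (B 0%N @^-1` G `&` S 0%N @^-1` [set s])) =
  (P (V 0%N @^-1` E) * P (A 0%N @^-1` F) *
   (P (B 0%N @^-1` G) * P (S 0%N @^-1` [set s])))%E.
Proof.
move=> mE mF mG.
pose X := [:: V 0%N @^-1` E; A 0%N @^-1` F; B 0%N @^-1` G; S 0%N @^-1` [set s]].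
have inj : injective (fun i : 'I_4 => nth_input i).
  by move=> i i' /nth_input_inj/val_inj.
have XE (i : 'I_4) : input_events A B S V (nth_input i) (nth set0 X i).
  case: i => -[|[|[|[|//]]]] _ /=.
  - by exists E => //; rewrite setTI.
  - by exists F => //; rewrite setTI.
  - by exists G => //; rewrite setTI.
  - by exists [set s].
have := indep inj XE; rewrite !big_ord_recr big_ord0 /= mul1e -muleA => <-.
congr (P _); apply/seteqP; split => w /=.
  by move=> [[? ?] [? ?]] [[|[|[|[|//]]]] ?] _.
move=> h; split; split.
- exact: (h (Ordinal (isT : 0 < 4)%N) I).
- exact: (h (Ordinal (isT : 1 < 4)%N) I).
- exact: (h (Ordinal (isT : 2 < 4)%N) I).
- exact: (h (Ordinal (isT : 3 < 4)%N) I).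
Qed.

End Inputs.

(** * Tails of the stationary backlogs *)

Section MeasurableExtrema.
Context {d : measure_display} {T : measurableType d} {R : realType} {I : Type}.
Variables (x0 : T -> R) (h : I -> T -> R).
Hypotheses (mx0 : measurable_fun setT x0) (mh : forall i, measurable_fun setT (h i)).

Lemma measurable_bigmax (r : seq I) (Q : pred I) :
  measurable_fun setT (fun w => \big[Num.max/x0 w]_(i <- r | Q i) h i w).
Proof.
elim: r => [|i r IH]; first by under eq_fun do rewrite big_nil.
under eq_fun do rewrite big_cons.
by case: (Q i) => //; exact: measurable_maxr.
Qed.

Lemma measurable_bigmin (r : seq I) (Q : pred I) :
  measurable_fun setT (fun w => \big[Num.min/x0 w]_(i <- r | Q i) h i w).
Proof.
elim: r => [|i r IH]; first by under eq_fun do rewrite big_nil.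
under eq_fun do rewrite big_cons.
by case: (Q i) => //; exact: measurable_minr.
Qed.

End MeasurableExtrema.

(** Whatever the sizes of its replicas, a job covers a given set of [nF - nJ + 1] servers
    with at least this probability: by [card_covers], [(nF - nJ + 1)`!] of the
    [N ^_ nF] equally likely choices of servers do it. This is the origin of the
    constant [K] of the theorem. *)
Definition cover_prob (R : realType) (N nF nJ : nat) : R :=
  ((nF - nJ + 1)`!)%:R / (N ^_ nF)%:R.

Lemma cover_prob_gt0 (R : realType) N nF nJ : (nF <= N)%N -> 0 < cover_prob R N nF nJ.
Proof. by move=> ?; rewrite divr_gt0// ltr0n ?fact_gt0// ffact_gt0. Qed.

Lemma cover_prob_le1 (R : realType) N nF nJ : (0 < nJ <= nF)%N -> (nF <= N)%N ->
  cover_prob R N nF nJ <= 1.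
Proof.
move=> /andP[j0 jF] FN.
rewrite ler_pdivrMr ?ltr0n ?ffact_gt0// mul1r ler_nat -bin_ffact.
apply: (@leq_trans nF`!); last by rewrite leq_pmull// bin_gt0.
by apply: leq_fact; lia.
Qed.

Lemma Kconst_cover_prob (R : realType) N nF nJ :
  Kconst R N nF nJ = (cover_prob R N nF nJ)^-1.
Proof. by rewrite /Kconst /cover_prob invf_div -natrM bin_ffact. Qed.

Section Model.
Context {R : realType} {d : measure_display} {Omega : measurableType d}.
Variables (P : probability Omega R) (N nF nJ : nat).
Variables (A : nat -> {RV P >-> R}) (B : nat -> {RV P >-> nF.-tuple R}).
Variable S : nat -> Omega -> {ffun 'I_nF -> 'I_N}.
Variables (V : nat -> {RV P >-> N.-tuple R}) (nu : probability R R).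
Hypotheses (nJ_itv : (0 < nJ <= nF)%N) (nF_le : (nF <= N)%N).
Hypothesis model : coc_fork_join P nJ A B S V.
Hypothesis steady : steady_state P V.
Local Notation H := (tail_prob nu).
Local Notation X := (size_stat P nJ B).
Local Notation kappa := (cover_prob R N nF nJ).

Variables (al b : R).
Hypothesis A_mean : (\int[P]_w (A 0%N w)%:E)%E = al%:E.
Hypothesis X_mean : (\int[P]_w (X w)%:E)%E = b%:E.
Hypothesis b_gt0 : 0 < b.
Hypothesis b_lt : b < al.
Hypothesis X_tail : forall x, 0 <= x ->
  (\int[lebesgue_measure]_(y in `]x, +oo[) P [set w | (y < X w)%R] = (b * H x)%:E)%E.
Hypothesis nu_pos : nu `]0, +oo[%classic = 1%E.
Hypothesis subexp : subexponential nu.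

Lemma size_stat_ge0 w : 0 <= X w.
Proof.
rewrite /size_stat; apply: (order_stat_ge_set nJ_itv (I := [set: 'I_nF]%SET)).
  by case/andP: nJ_itv => j0 jn; rewrite cardsT card_ord ltn_subrL j0 (leq_trans j0).
by move=> i _; exact: (size_ge0 model).
Qed.

Lemma measurable_order_stat_id : measurable_fun setT (fun t : nF.-tuple R => order_stat nJ t).
Proof. exact: (measurable_order_stat (t := id)). Qed.

Lemma measurable_size_stat : measurable_fun setT X.
Proof. exact: (measurableT_comp measurable_order_stat_id). Qed.

Lemma servers_prob s : P (S 0%N @^-1` [set s]) =
  (if injectiveb s then (N ^_ nF)%:R^-1%:E else 0)%E.
Proof.
case: ifPn => [/injectiveP|]; first exact: (servers_uniform model).
move=> /injectiveP ninj; rewrite (_ : _ @^-1` _ = set0) ?measure0//.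
by apply/seteqP; split => // w /= Sw; apply: ninj; rewrite -Sw; exact: (servers_distinct model).
Qed.

Lemma measurable_first_job (h : {ffun 'I_nF -> 'I_N} -> nF.-tuple R -> R) :
  (forall s, measurable_fun setT (h s)) -> measurable_fun setT (fun w => h (S 0%N w) (B 0%N w)).
Proof.
move=> mh; apply: (measurable_select (h := fun s w => h s (B 0%N w))).
  by move=> s; exact: (servers_measurable model).
by move=> s; exact: (measurableT_comp (mh s)).
Qed.

(** Given the servers of the first job, [h] is a function of its sizes alone, and the
    four inputs are independent. *)
Lemma indep_backlog (u : N.-tuple R -> R) (h : {ffun 'I_nF -> 'I_N} -> nF.-tuple R -> R)
    (E F G : set R) : measurable_fun setT u -> (forall s, measurable_fun setT (h s)) ->
    measurable E -> measurable F -> measurable G ->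
  let Z w := h (S 0%N w) (B 0%N w) in
  P ((u \o V 0%N) @^-1` E `&` A 0%N @^-1` F `&` Z @^-1` G) =
  (P ((u \o V 0%N) @^-1` E) * P (A 0%N @^-1` F) * P (Z @^-1` G))%E.
Proof.
move=> mu mh mE mF mG Z.
have mS s : measurable (S 0%N @^-1` [set s]) by exact: (servers_measurable model).
have mZ : measurable_fun setT Z by exact: measurable_first_job.
have mUE : measurable (u @^-1` E) by exact: measurable_preimage.
have muV : measurable_fun setT (u \o V 0%N) by exact: measurableT_comp.
have mZG : measurable (Z @^-1` G) by exact: measurable_preimage.
have mhG s : measurable (h s @^-1` G) by exact: measurable_preimage.
have mUA : measurable ((u \o V 0%N) @^-1` E `&` A 0%N @^-1` F).
  by apply: measurableI; exact: measurable_preimage.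
rewrite (law_total P mS); last exact: measurableI.
rewrite [P (Z @^-1` G)](law_total P mS)// ge0_sume_distrr//.
apply: eq_bigr => s _.
have eZ : Z @^-1` G `&` S 0%N @^-1` [set s] =
    B 0%N @^-1` (h s @^-1` G) `&` S 0%N @^-1` [set s].
  by apply/seteqP; split => w /= [hw Sw]; split => //; move: hw; rewrite /Z /= Sw.
rewrite -(setIA _ (Z @^-1` G)) eZ; have indep4 := indep_first_job (inputs_independent model) s.
have eU : (u \o V 0%N) @^-1` E = V 0%N @^-1` (u @^-1` E) by [].
rewrite !eU (indep4 _ _ _ mUE mF (mhG s)).
congr (_ * _)%E.
have := indep4 setT setT _ measurableT measurableT (mhG s).
by rewrite !preimage_setT !setTI !probability_setT !mul1e.
Qed.

Let max_backlog (v : N.-tuple R) := \big[Num.max/0]_(k < N) tnth v k.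

Let mmax : measurable_fun setT max_backlog.
Proof. by apply: measurable_bigmax => // k; exact: measurable_tnth. Qed.

Lemma backlog_stationary (u : N.-tuple R -> R) n y : measurable_fun setT u ->
  P [set w | y < u (V n w)] = P [set w | y < u (V 0%N w)].
Proof.
move=> mu.
have pre k : (u \o V k) @^-1` `]y, +oo[ = [set w | y < u (V k w)].
  by apply/seteqP; split => w /=; rewrite in_itv /= andbT.
rewrite -(pre n) -(pre 0%N).
exact: (steady n (measurable_preimage mu (measurable_itv _))).
Qed.

Let recursion n w k : tnth (V n.+1 w) k =
  Num.max 0 (tnth (assign_job nJ (V n w) (S n w) (B n w)) k - A n w).
Proof. by rewrite (workload_recursion model) tnth_mktuple. Qed.

Let f (u : N.-tuple R -> R) x := fine (P [set w | x < u (V 0%N w)]).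

(** A job is completed within its [size_stat] after the largest backlog, so that no
    server is occupied longer than that by the job: the largest backlog grows
    no faster than the one of a single server that works on the whole
    [size_stat] of every job. *)
Lemma max_backlog_limsup dl : 0 < dl ->
  \forall x \near +oo, f max_backlog x <= (b / (al - b) + dl) * H x.
Proof.
apply: (tail_ratio_limsup (D := both_large_tail nu)) => //.
- exact: tail_prob_gt0.
- exact: tail_prob_nonincr.
- exact: long_tailed.
- exact: both_large_small.
- by move=> x; rewrite fine_ge0.
- move=> x; rewrite -[leRHS]/(fine 1%E) -(probability_setT P).
  apply: (fine_measure_le (prob_lty P)) => //.
  exact: (measurable_ltr_set (measurable_cst x) (measurableT_comp mmax _)).
apply: (upper_step (M := max_backlog \o V 0%N) (M1 := max_backlog \o V 1%N) (A := A 0%N)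
  (B := X)) => //.
- exact: measurableT_comp.
- exact: measurableT_comp.
- exact: measurable_size_stat.
- exact: (interarrival_ge0 model).
- exact: size_stat_ge0.
- by move=> y; exact: backlog_stationary.
- move=> w; apply: bigmax_le; first by rewrite le_max lexx.
  move=> k _; rewrite recursion ge_max !le_max lexx /=.
  apply/orP; right; rewrite lerD2r (le_trans (assign_job_le _ _ _ _ _))// ge_max.
  have vm k' : tnth (V 0%N w) k' <= max_backlog (V 0%N w) by exact: le_bigmax.
  rewrite (completion_time_le nJ_itv)// andbT (le_trans (vm k))// lerDl.
  exact: size_stat_ge0.
- move=> E F mE mF.
  have := indep_backlog mmax (h := fun _ _ => 0) (fun=> measurable_cst _) mE mF measurableT.
  by rewrite /= preimage_setT setIT probability_setT mule1.
- move=> E F mE mF.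
  have := indep_backlog mmax (h := fun=> order_stat nJ) (fun=> measurable_order_stat_id)
    mE measurableT mF.
  by rewrite /= preimage_setT setIT probability_setT mule1.
Qed.

Section Cover.
Variable s0 : {ffun 'I_nF -> 'I_N}.
Hypothesis s0_inj : injective s0.
Variable k0 : 'I_N.
Let T : {set 'I_N} := [set s0 i | i in top_indices nJ]%SET.
Hypothesis k0T : k0 \in T.

Let min_backlog (v : N.-tuple R) := \big[Num.min/tnth v k0]_(k in T) tnth v k.

Let mmin : measurable_fun setT min_backlog.
Proof. by apply: measurable_bigmin => // *; exact: measurable_tnth. Qed.

Let cover_set s : set (nF.-tuple R) := [set t | covers nJ T t s].

Let mcover s : measurable (cover_set s).
Proof.
rewrite (_ : cover_set s = \bigcap_(k in [set k | k \in T])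
    \bigcup_(i in [set i | s i == k]) [set t : nF.-tuple R | order_stat nJ t <= tnth t i]).
  apply: fin_bigcap_measurable => // k _.
  apply: fin_bigcup_measurable => [|i _]; first exact: finite_finset.
  by apply: measurable_ler_set; [exact: measurable_order_stat_id|exact: measurable_tnth].
apply/seteqP; split => t /=.
  move=> /forall_inP h k /= /h /existsP[i /andP[si le]]; exists i => //.
by move=> h; apply/forall_inP => k /h [i /= si le]; apply/existsP; exists i; rewrite si.
Qed.

Let gain s (t : nF.-tuple R) := \1_(cover_set s) t * order_stat nJ t.

Let mgain s : measurable_fun setT (gain s).
Proof.
apply: measurable_funM; first exact: measurable_indic.
exact: measurable_order_stat_id.
Qed.

(* a lower bound for the growth of the smallest backlog on [T] through the first job *)
Let Z w := gain (S 0%N w) (B 0%N w).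

Let Z_tail (t : R) : 0 <= t ->
  (kappa%:E * P [set w | (t < X w)%R] <= P [set w | (t < Z w)%R])%E.
Proof.
move=> t0.
have mS s : measurable (S 0%N @^-1` [set s]) by exact: (servers_measurable model).
have mX : measurable [set w | t < X w].
  by apply: measurable_ltr_set => //; exact: measurable_size_stat.
have mZ : measurable [set w | t < Z w].
  by apply: measurable_ltr_set => //; exact: measurable_first_job.
pose G (s : {ffun 'I_nF -> 'I_N}) : set Omega :=
  if injectiveb s then B 0%N @^-1` (gain s @^-1` `]t, +oo[) else set0.
have mgt s : measurable (gain s @^-1` `]t, +oo[) by exact: measurable_preimage.
have mG s : measurable (G s).
  by rewrite /G; case: ifP => // _; rewrite -[X in measurable X]setTI; exact: measurable_funP.
have GE s : (P ([set w | (t < Z w)%R] `&` S 0%N @^-1` [set s]) =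
    (N ^_ nF)%:R^-1%:E * P (G s))%E.
  have -> : [set w | t < Z w] `&` S 0%N @^-1` [set s] =
      B 0%N @^-1` (gain s @^-1` `]t, +oo[) `&` S 0%N @^-1` [set s].
    by apply/seteqP; split => w /=; rewrite in_itv /= andbT => -[+ Sw]; rewrite /Z Sw.
  have := indep_first_job (inputs_independent model) s measurableT measurableT (mgt s).
  rewrite !preimage_setT !setTI !probability_setT !mul1e => ->; rewrite servers_prob /G.
  by case: ifP => _; [rewrite muleC|rewrite measure0 !mule0].
rewrite (law_total P mS mZ) (eq_bigr _ (fun s _ => GE s)) -ge0_sume_distrr//.
rewrite /cover_prob mulrC EFinM -muleA; apply: lee_wpmul2l; first by rewrite lee_fin invr_ge0 ler0n.
apply: sum_measure_ge => // w tX.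
rewrite -card_top_indices//.
apply: (@le_trans _ _ (#|[set s : {ffun 'I_nF -> 'I_N} |
    injectiveb s && covers nJ T (B 0%N w) s]%SET|)%:R).
  by rewrite ler_nat; exact: card_covers.
rewrite -sum1dep_card natr_sum big_mkcond; apply: ler_sum => s _.
case: ifPn => [/andP[sinj scov]|_]; last by rewrite indicE ler0n.
rewrite indicE /G sinj mem_set//= in_itv /= andbT /gain indicE mem_set// mul1r.
exact: tX.
Qed.

Let mZ : measurable_fun setT Z.
Proof. exact: measurable_first_job. Qed.

Let X_tail_between x y : 0 <= x -> x <= y ->
  (\int[lebesgue_measure]_(t in `]x, y[) P [set w | (t < X w)%R] = (b * (H x - H y))%:E)%E.
Proof.
move=> x0 xy; have mX := measurable_size_stat.
rewrite -integral_capped//.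
have fin := integral_capped_fin P x y mX.
have : (\int[P]_w (Num.max 0 (X w - x))%:E =
    \int[P]_w (Num.max 0 (Num.min (X w) y - x))%:E + \int[P]_w (Num.max 0 (X w - y))%:E)%E.
  rewrite -ge0_integralD_real.
  - apply: eq_integral => w _; congr (_%:E).
    have [Xy|yX] := leP (X w) y.
      by rewrite (@max_l _ _ 0 (X w - y)) ?subr_le0// addr0.
    by rewrite !max_r ?subr_ge0// ?ltW// ?(le_lt_trans xy)//; lra.
  - by apply: measurable_maxr => //; apply: measurable_funB => //; exact: measurable_minr.
  - by apply: measurable_maxr => //; exact: measurable_funB.
  - by move=> w; rewrite le_max lexx.
  - by move=> w; rewrite le_max lexx.
rewrite (integral_excess P x mX) (integral_excess P y mX) !X_tail//;
  last exact: le_trans xy.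
rewrite -(fineK fin) -EFinD => -[e]; congr (_%:E); lra.
Qed.

Let kappa_gt0 : 0 < kappa. Proof. exact: cover_prob_gt0. Qed.

Let Z_tail_between x y : 0 <= x -> x <= y ->
  ((kappa * b * (H x - H y))%:E <=
   \int[lebesgue_measure]_(t in `]x, y[) P [set w | (t < Z w)%R])%E.
Proof.
move=> x0 xy; rewrite -mulrA EFinM -X_tail_between//.
have mtail (Y : Omega -> R) : measurable_fun setT Y ->
    measurable_fun `]x, y[ (fun t : R => P [set w | t < Y w]).
  by move=> mY; apply: measurable_funTS; exact: measurable_tail.
have mX := measurable_size_stat.
rewrite -ge0_integralZl//; last 2 first.
- exact: mtail.
- by rewrite lee_fin ltW.
apply: ge0_le_integral => //.
- by move=> t _; rewrite mule_ge0// lee_fin ltW.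
- by apply: measurable_funeM; exact: mtail.
- exact: mtail.
by move=> t; rewrite /= in_itv /= => /andP[xt _]; apply: Z_tail; rewrite ltW// (le_lt_trans x0).
Qed.

(** The smallest backlog on [T] grows at least like that of a single server that works
    on a fraction [kappa] of the jobs. *)
Lemma min_backlog_liminf dl : 0 < dl ->
  \forall x \near +oo, (kappa * b / (al - kappa * b) - dl) * H x <= f min_backlog x.
Proof.
move=> dl0.
have mA : measurable_fun setT (A 0%N) by [].
have mU n : measurable_fun setT (min_backlog \o V n) by exact: measurableT_comp.
have cb : kappa * b <= b by rewrite ler_piMl ?cover_prob_le1// ltW.
apply: (lower_limit (p := fun t => fine (P [set w | A 0%N w <= t]))) => //.
- exact: tail_prob_gt0.
- exact: long_tailed.
- exact: (tail_cvg0 P (mU 0%N)).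
- rewrite (_ : (fun t => _) = fun t => 1 - fine (P [set w | t < A 0%N w])).
    by rewrite -[X in _ --> X]subr0; apply: cvgB; [exact: cvg_cst|exact: tail_cvg0].
  apply/funext => t; rewrite (_ : [set w | _] = ~` [set w | t < A 0%N w]).
    by rewrite probability_setC ?fineB ?(measure_fin_num (prob_lty P))//; exact: measurable_ltr_set.
  by apply/seteqP; split => w /=; rewrite leNgt => /negP.
- move=> t; rewrite -[leRHS]/(fine 1%E) -(probability_setT P).
  apply: (fine_measure_le (prob_lty P)) => //.
  exact: (measurable_ler_set mA (measurable_cst t)).
- by move=> x; rewrite fine_ge0.
- by rewrite mulr_gt0.
- exact: le_lt_trans b_lt.
apply: (lower_step (U := min_backlog \o V 0%N) (U1 := min_backlog \o V 1%N) (X := Z)) => //.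
- by move=> w; apply: le_bigmin => [|k _]; exact: (initial_ge0 model).
- exact: (interarrival_ge0 model).
- move=> w; rewrite mulr_ge0 ?indicE ?ler0n//; exact: size_stat_ge0.
- by move=> y; exact: backlog_stationary.
- move=> w /=.
  have step k : k \in T -> min_backlog (V 0%N w) + Z w - A 0%N w <= tnth (V 1%N w) k.
    move=> kT; rewrite recursion le_max lerD2r; apply/orP; right.
    have Uk k' : k' \in T -> min_backlog (V 0%N w) <= tnth (V 0%N w) k'.
      by move=> k'T; apply: bigmin_le_cond.
    rewrite /Z /gain indicE; case: (boolP (_ \in _)) => [|_].
      move=> /set_mem cov; rewrite mul1r.
      apply: (covers_assign_job nJ_itv _ _ cov) => //.
        exact: (servers_distinct model).
      rewrite card_imset// card_top_indices//; lia.
    rewrite mul0r addr0 (le_trans (Uk k kT))//; apply: assign_job_ge => i.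
    exact: (size_ge0 model).
  by apply: le_bigmin => [|k kT]; exact: step.
- by move=> E F G mE mF mG; exact: indep_backlog.
- by rewrite mulr_ge0// ltW.
Qed.

(** At most [nJ - 1] of the servers [s0] are outside [T], so the [nJ]-th smallest wait is
    at least the smallest backlog on [T]. *)
Lemma wait_liminf dl : 0 < dl ->
  \forall x \near +oo, (kappa * b / (al - kappa * b) - dl) * H x <=
    f (fun v => order_stat nJ (waiting_times v s0)) x.
Proof.
move=> /min_backlog_liminf; apply: filterS => x /le_trans; apply.
have mwait : measurable_fun setT
    (fun w => order_stat nJ (waiting_times (V 0%N w) s0)).
  apply: measurable_order_stat => //; exact: measurable_waiting_times.
apply: (fine_measure_le (prob_lty P)).
- exact: (measurable_ltr_set (measurable_cst x) (measurableT_comp mmin _)).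
- exact: measurable_ltr_set.
move=> w /= /lt_le_trans; apply.
apply: (wait_stat_ge nJ_itv (J := top_indices nJ)).
  rewrite card_top_indices//; lia.
by move=> i iJ; apply: bigmin_le_cond; apply: imset_f.
Qed.

End Cover.

Let wait_tail (s : {ffun 'I_nF -> 'I_N}) := f (fun v => order_stat nJ (waiting_times v s)).

Let mwait n (s : {ffun 'I_nF -> 'I_N}) x :
  measurable [set w | x < order_stat nJ (waiting_times (V n w) s)].
Proof.
apply: measurable_ltr_set => //; apply: measurable_order_stat => //.
exact: measurable_waiting_times.
Qed.

Let choice_prob n (s : {ffun 'I_nF -> 'I_N}) := fine (P (S n @^-1` [set s])).

Let measurable_choice n s : measurable (S n @^-1` [set s]).
Proof. exact: (servers_measurable model). Qed.

Lemma measurable_wait_stat n x : measurable [set w | x < wait_stat P nJ S V n w].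
Proof.
apply: measurable_ltr_set => //.
apply: (measurable_select (h := fun s w => order_stat nJ (waiting_times (V n w) s))) => // s.
by apply: measurable_order_stat => //; exact: measurable_waiting_times.
Qed.

(** The backlogs found by job [n] are independent of its servers and have the law of
    the initial ones, so that only the initial backlogs have to be studied. *)
Let wait_stat_mixture n x :
  fine (P [set w | x < wait_stat P nJ S V n w]) = \sum_s choice_prob n s * wait_tail s x.
Proof.
apply/EFin_inj; rewrite -probE; last exact: measurable_wait_stat.
rewrite (law_total P (measurable_choice n)); last exact: measurable_wait_stat.
rewrite -sumEFin; apply: eq_bigr => s _.
have mos : measurable_fun setT (fun v : N.-tuple R => order_stat nJ (waiting_times v s)).
  by apply: measurable_order_stat => //; exact: (measurable_waiting_times (v := id)).
rewrite EFinM /choice_prob /wait_tail /f -!probE// -(backlog_stationary n x mos) muleC.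
have -> : [set w | x < wait_stat P nJ S V n w] `&` S n @^-1` [set s] =
    V n @^-1` [set v | x < order_stat nJ (waiting_times v s)] `&` S n @^-1` [set s].
  by apply/seteqP; split => w /= [+ Sw]; rewrite /wait_stat Sw.
apply: (backlogs_indep_servers (servers_measurable model) (inputs_independent model) nJ_itv).
  exact: (workload_recursion model).
exact: measurable_ltr_set.
Qed.

Let choice_prob_sum n : \sum_s choice_prob n s = 1.
Proof.
apply/EFin_inj; rewrite -sumEFin -[RHS](probability_setT P).
rewrite (law_total P (measurable_choice n))//; apply: eq_bigr => s _.
by rewrite setTI -probE.
Qed.

Let choice_prob_ge0 n s : 0 <= choice_prob n s.
Proof. by rewrite fine_ge0. Qed.

Lemma wait_stat_limsup n dl : 0 < dl ->
  \forall x \near +oo, fine (P [set w | x < wait_stat P nJ S V n w]) <=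
    (b / (al - b) + dl) * H x.
Proof.
move=> /max_backlog_limsup; apply: filterS => x; apply: le_trans.
rewrite wait_stat_mixture -[leRHS]mul1r -(choice_prob_sum n) mulr_suml.
apply: ler_sum => s _; apply: ler_wpM2l => //.
apply: (fine_measure_le (prob_lty P)) => //.
  exact: (measurable_ltr_set (measurable_cst x) (measurableT_comp mmax _)).
move=> w /= /lt_le_trans; apply; apply: wait_stat_le => // k; exact: le_bigmax.
Qed.

Lemma wait_stat_liminf n dl : 0 < dl ->
  let c := kappa * b in
  \forall x \near +oo, (c / (al - c) - dl) * H x <=
    fine (P [set w | x < wait_stat P nJ S V n w]).
Proof.
move=> dl0 c.
have inj_bound (s : {ffun 'I_nF -> 'I_N}) : \forall x \near +oo,
    injectiveb s -> (c / (al - c) - dl) * H x <= wait_tail s x.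
  have [/injectiveP sinj|/negP ns] := boolP (injectiveb s); last first.
    by apply: filterE => x h; case: ns.
  have [i0 i0J] : exists i, i \in @top_indices nF nJ.
    by apply/card_gt0P; rewrite card_top_indices// addn1.
  have := wait_liminf sinj (imset_f s i0J) dl0.
  by apply: filterS => x ? _.
near=> x.
have hx : forall s : {ffun 'I_nF -> 'I_N},
    injectiveb s -> (c / (al - c) - dl) * H x <= wait_tail s x.
  by near: x; exact: filter_forall inj_bound.
rewrite wait_stat_mixture -[leLHS]mul1r -(choice_prob_sum n) mulr_suml.
apply: ler_sum => s _.
have [sinj|ninj] := boolP (injectiveb s).
  by apply: ler_wpM2l => //; exact: hx.
rewrite /choice_prob (_ : _ @^-1` _ = set0) ?measure0 ?mul0r//.
apply/seteqP; split => // w /= Sw; move/negP: ninj; apply; apply/injectiveP.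
by rewrite -Sw; exact: (servers_distinct model).
Unshelve. all: by end_near.
Qed.

End Model.

(** * The waiting time *)

Lemma subexponential_tail_neq0 {R : realType} (nu : probability R R) :
  subexponential nu -> exists2 x, 0 <= x & nu `]x, +oo[%classic != 0%E.
Proof.
move=> /cvgrPdist_lt /(_ 1 ltr01) h.
have [x [/= + x0]] := filter_ex (filterI h (nbhs_pinfty_ge (num_real 0))).
move=> hx; exists x => //; apply/eqP => nu0; move: hx.
by rewrite /tail_prob nu0 /= invr0 mulr0 subr0 normr_nat; lra.
Qed.

Theorem theorem2 (R : realType) (d : measure_display) (Omega : measurableType d)
    (P : probability Omega R) (N nF nJ : nat)
    (A : nat -> {RV P >-> R}) (B : nat -> {RV P >-> nF.-tuple R})
    (S : nat -> Omega -> {ffun 'I_nF -> 'I_N})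
    (V : nat -> {RV P >-> N.-tuple R}) (Bres : probability R R) :
  (1 <= nJ)%N -> (nJ <= nF)%N -> (nF <= N)%N ->
  coc_fork_join P nJ A B S V ->
  steady_state P V ->
  (rhoU P nJ A B < 1)%E ->
  (forall x : R, 0 <= x ->
     Bres `]x, +oo[%classic = residual_tail P (size_stat P nJ B) x) ->
  subexponential Bres ->
  forall n : nat,
  exists epsL epsU : R -> R,
    [/\ epsL x @[x --> +oo] --> (0 : R),
        epsU x @[x --> +oo] --> (0 : R) &
        \forall x \near +oo,
          (1 + epsL x) *
            (fine (rhoL P N nJ A B) / (1 - fine (rhoL P N nJ A B))) * tail_prob Bres x
            <= fine (P [set w | x < wait_stat P nJ S V n w])
          /\
          fine (P [set w | x < wait_stat P nJ S V n w])
            <= (1 + epsU x) *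
            (fine (rhoU P nJ A B) / (1 - fine (rhoU P nJ A B))) * tail_prob Bres x].
Proof.
move=> nJ1 nJF nFN model steady rho_lt1 Bres_tail subexp n.
have nJ_itv : (0 < nJ <= nF)%N by rewrite nJ1.
pose X := size_stat P nJ B.
have X0 w : 0 <= X w by exact: (size_stat_ge0 nJ_itv model).
have mX : measurable_fun setT X by exact: measurable_size_stat.
have EX0 : (0 <= \int[P]_w (X w)%:E)%E by apply: integral_ge0 => w _; rewrite lee_fin.
have XE : ('E_P[X] = \int[P]_w (X w)%:E)%E by rewrite unlock.
have AE : ('E_P[A 0%N] = \int[P]_w (A 0%N w)%:E)%E by rewrite unlock.
have excess_le x : 0 <= x ->
    (\int[lebesgue_measure]_(y in `]x, +oo[) P [set w | (y < X w)%R] <=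
     \int[P]_w (X w)%:E)%E.
  move=> x0; rewrite -integral_excess//; apply: ge0_le_integral => //.
  - by move=> w _; rewrite lee_fin le_max lexx.
  - by apply/measurable_EFinP; apply: measurable_maxr => //; exact: measurable_funB.
  - exact/measurable_EFinP.
  - by move=> w _; rewrite lee_fin ge_max X0 lerBlDr lerDl.
(* A zero or infinite mean of [X] would make the residual tail vanish, as [0^-1 * 0 = 0] and
   [+oo^-1 = 0] in the extended reals; subexponentiality excludes this. *)
have [b b_gt0 X_mean] : exists2 b, 0 < b & (\int[P]_w (X w)%:E = b%:E)%E.
  have [x x0] := subexponential_tail_neq0 subexp.
  rewrite Bres_tail// /residual_tail XE; have := excess_le x x0; move: EX0.
  case: (\int[P]_w (X w)%:E)%E => [b| |] //; last by rewrite invey mul0e eqxx.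
  rewrite lee_fin le_eqVlt => /orP[/eqP <-|b0]; last by exists b.
  rewrite inve0 => le0; have /eqP -> : (\int[lebesgue_measure]_(y in `]x, +oo[)
      P [set w | (y < X w)%R] == 0)%E by rewrite eq_le le0 integral_ge0.
  by rewrite mule0 eqxx.
have [al al_gt_b A_mean] : exists2 al, b < al & (\int[P]_w (A 0%N w)%:E = al%:E)%E.
  have A0 : (0 <= \int[P]_w (A 0%N w)%:E)%E.
    by apply: integral_ge0 => w _; rewrite lee_fin (interarrival_ge0 model).
  have := interarrival_mean model; move: rho_lt1; rewrite /rhoU XE X_mean AE; move: A0.
  case: (\int[P]_w (A 0%N w)%:E)%E => [al| |] // al0 rho _; exists al => //.
  move: al0; rewrite lee_fin le_eqVlt => /orP[/eqP al0|al0].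
    by move: rho; rewrite -al0 inve0 gt0_muley ?lte_fin.
  by move: rho; rewrite inver gt_eqF// -EFinM lte_fin ltr_pdivrMr ?mul1r.
have X_tail x : 0 <= x -> (\int[lebesgue_measure]_(y in `]x, +oo[)
    P [set w | (y < X w)%R] = (b * tail_prob Bres x)%:E)%E.
  move=> x0; rewrite EFinM -tail_probE Bres_tail// /residual_tail XE X_mean inver gt_eqF//.
  by rewrite muleA -EFinM divff ?gt_eqF// mul1e.
have nu_pos : Bres `]0, +oo[%classic = 1%E.
  rewrite Bres_tail// /residual_tail XE X_mean -integral_excess//.
  under eq_integral do rewrite subr0 max_r//.
  by rewrite X_mean inver gt_eqF// -EFinM mulVf ?gt_eqF.
have al_gt0 : 0 < al by exact: lt_trans al_gt_b.
have H0 x := tail_prob_gt0 subexp x.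
have CU : fine (rhoU P nJ A B) / (1 - fine (rhoU P nJ A B)) = b / (al - b).
  rewrite /rhoU XE X_mean AE A_mean inver gt_eqF//=.
  by field; rewrite !gt_eqF ?subr_gt0.
set kappa := cover_prob R N nF nJ.
have K_inv : Kconst R N nF nJ = kappa^-1 by exact: Kconst_cover_prob.
have kappa0 : 0 < kappa by exact: cover_prob_gt0.
have kappa_le1 : kappa <= 1 by exact: cover_prob_le1.
have CL : fine (rhoL P N nJ A B) / (1 - fine (rhoL P N nJ A B)) =
    kappa * b / (al - kappa * b).
  rewrite /rhoL XE X_mean AE A_mean K_inv -EFinM inver gt_eqF ?mulr_gt0 ?invr_gt0//=.
  have alk : al - kappa * b != 0.
    by rewrite gt_eqF// subr_gt0 (le_lt_trans _ al_gt_b)// ler_piMl// ltW.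
  by field; rewrite alk !gt_eqF.
have cal : kappa * b < al by rewrite (le_lt_trans _ al_gt_b)// ler_piMl// ltW.
have CL0 : 0 < kappa * b / (al - kappa * b).
  by rewrite divr_gt0 ?subr_gt0// mulr_gt0.
have CU0 : 0 < b / (al - b) by rewrite divr_gt0 ?subr_gt0.
have [|epsL eL hL] := lower_asymptotics
    (p := fun x => fine (P [set w | x < wait_stat P nJ S V n w])) CL0 H0.
  by move=> dl dl0; exact: (wait_stat_liminf _ _ model).
have [|epsU eU hU] := upper_asymptotics
    (p := fun x => fine (P [set w | x < wait_stat P nJ S V n w])) CU0 H0.
  by move=> dl dl0; exact: (wait_stat_limsup _ model).
exists epsL, epsU; split => //.
by apply: nearW => x; rewrite CL CU; split; [exact: hL|exact: hU].
Qed.
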